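(* Consider the impulsive linear control system on $[0,b]$ with data $H,U,A,S,B,C_k,D_k,t_k$ ($k=1,\dots,p$) described in the context, and let $M$, $\Theta_0^{t_p}$, $\Gamma_{t_p}^b$, $\widetilde\Theta_0^{t_p}$, $\widetilde\Gamma_{t_p}^b$ be the bounded operators defined there. The following conditions are equivalent. (a) The system is approximately controllable on $[0,b]$. (b) For $\varphi\in H$, $M^*\varphi=0$ implies $\varphi=0$. (c) The operator $\Theta_0^{t_p}+\Gamma_{t_p}^b+\widetilde\Theta_0^{t_p}+\widetilde\Gamma_{t_p}^b$ is positive. (d) $\varepsilon\left(\varepsilon I+\Theta_0^{t_p}+\Gamma_{t_p}^b+\widetilde\Theta_0^{t_p}+\widetilde\Gamma_{t_p}^b\right)^{-1}$ converges to the zero operator as $\varepsilon\to0^+$ in the strong operator topology. (e) $\varepsilon\left(\varepsilon I+\Theta_0^{t_p}+\Gamma_{t_p}^b+\widetilde\Theta_0^{t_p}+\widetilde\Gamma_{t_p}^b\right)^{-1}$ converges to the zero operator as $\varepsilon\to0^+$ in the weak operator topology.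
   Context: **Setting.** $H$ and $U$ are Hilbert spaces, $b>0$, $p\ge1$, $0=t_0<t_1<\dots<t_p<t_{p+1}=b$. $A$ is the infinitesimal generator of a strongly continuous semigroup $S(t)$, $t\ge0$, of bounded linear operators on $H$; $B\in L(U,H)$, $C_k\in L(H,H)$, $D_k\in L(U,H)$ for $k=1,\dots,p$ are bounded linear operators. The system is $$x'(t)=Ax(t)+Bu(t),\ t\in[0,b]\setminus\{t_1,\dots,t_p\};\qquad \Delta x(t_k)=C_kx(t_k)+D_kv_k,\ k=1,\dots,p;\qquad x(0)=x_0,$$ where $x_0\in H$, the control is $w=(u,\{v_k\}_{k=1}^p)\in L^2([0,b],U)\times U^p$, $\Delta x(t_k)=x(t_k^+)-x(t_k^-)$, and $x(t_k^-)=x(t_k)$. Its mild solution is the left-continuous function given by $x(t)=S(t)x_0+\int_0^tS(t-s)Bu(s)\,ds$ for $0\le t\le t_1$, and, for $k=1,\dots,p$, $x(t_k^+)=(I+C_k)x(t_k)+D_kv_k$ and $x(t)=S(t-t_k)x(t_k^+)+\int_{t_k}^tS(t-s)Bu(s)\,ds$ for $t_k<t\le t_{k+1}$. **Approximate controllability on $[0,b]$.** For every $x_0\in H$, every $h\in H$ and every $\delta>0$ there is a control $(u,\{v_k\})\in L^2([0,b],U)\times U^p$ whose mild solution satisfies $\|x(b)-h\|<\delta$. **Notation.** $S_C(t_i,s):=(I+C_i)S(t_i-s)$ for $t_{i-1}\le s\le t_i$, and $S_C^*(t_i,s)=S^*(t_i-s)(I+C_i^* )$ is its adjoint. Products are ordered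 from left to right as written: $\prod_{j=p}^{i}S_C(t_j,t_{j-1})=S_C(t_p,t_{p-1})S_C(t_{p-1},t_{p-2})\cdots S_C(t_i,t_{i-1})$ and $\prod_{k=i}^{p}S_C^*(t_k,t_{k-1})=S_C^*(t_i,t_{i-1})\cdots S_C^*(t_p,t_{p-1})$; empty products ($\prod_{j=p}^{p+1}$, $\prod_{k=p+1}^{p}$) are the identity, and empty sums are $0$. Operator-valued integrals are understood pointwise (strongly). $L^2([0,b],U)\times U^p$ is a Hilbert space with inner product $\langle w_1,w_2\rangle_1=\int_0^b\langle u_1(s),u_2(s)\rangle_U\,ds+\sum_{k=1}^p\langle v_{1k},v_{2k}\rangle_U$. The bounded linear operator $M:L^2([0,b],U)\times U^p\to H$ is $$Mw=S(b-t_p)\sum_{i=1}^p\prod_{j=p}^{i+1}S_C(t_j,t_{j-1})\int_{t_{i-1}}^{t_i}S_C(t_i,s)Bu(s)\,ds+\int_{t_p}^bS(b-s)Bu(s)\,ds$$ $$\quad+S(b-t_p)\sum_{i=2}^p\prod_{j=p}^{i}S_C(t_j,t_{j-1})D_{i-1}v_{i-1}+S(b-t_p)D_pv_p,$$ and $M^*$ is its Hilbert-space adjoint. The operators on $H$ are $$\Gamma_{t_p}^b=\int_{t_p}^bS(b-s)BB^*S^*(b-s)\,ds,\qquad \widetilde\Gamma_{t_p}^b=S(b-t_p)D_pD_p^*S^*(b-t_p),$$ $$\Theta_0^{t_p}=S(b-t_p)\sum_{i=1}^p\prod_{j=p}^{i+1}S_C(t_j,t_{j-1})\int_{t_{i-1}}^{t_i}S_C(t_i,s)BB^*S_C^*(t_i,s)\,ds\prod_{k=i+1}^pS_C^*(t_k,t_{k-1})\,S^*(b-t_p),$$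 $$\widetilde\Theta_0^{t_p}=S(b-t_p)\sum_{i=2}^p\prod_{j=p}^{i}S_C(t_j,t_{j-1})D_{i-1}D_{i-1}^*\prod_{k=i}^pS_C^*(t_k,t_{k-1})\,S^*(b-t_p).$$ A bounded self-adjoint operator $T$ on $H$ is called positive if $\langle T\varphi,\varphi\rangle>0$ for all $\varphi\in H$, $\varphi\ne0$. *)

(* Defs.v *)
From HB Require Import structures.
From mathcomp Require Import all_boot all_order all_algebra.
From mathcomp Require Import complex sesquilinear.
From mathcomp Require Import all_classical all_reals all_analysis.

Set Implicit Arguments.
Unset Strict Implicit.
Unset Printing Implicit Defensive.

Import Order.TTheory GRing.Theory Num.Theory.
Import numFieldNormedType.Exports.

Local Open Scope classical_set_scope.
Local Open Scope ring_scope.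

(* Hilbert spaces over the real or over the complex numbers are treated
   uniformly: [scalars R RealScalars] is R and [scalars R ComplexScalars] is
   R[i]. *)
Variant scalar_kind := RealScalars | ComplexScalars.

Definition scalars (R : realType) (k : scalar_kind) : numFieldType :=
  match k with
  | RealScalars => R : numFieldType
  | ComplexScalars => R[i] : numFieldType
  end.

Definition of_real (R : realType) (k : scalar_kind) : R -> scalars R k :=
  match k with
  | RealScalars => fun r => r
  | ComplexScalars => fun r => r%:C%C
  end.

Definition re_part (R : realType) (k : scalar_kind) : scalars R k -> R :=
  match k with
  | RealScalars => fun x => x
  | ComplexScalars => fun x => complex.Re x
  end.

Definition sconj (R : realType) (k : scalar_kind) :
    scalars R k -> scalars R k :=
  match k with
  | RealScalars => fun x => x
  | ComplexScalars => fun x => conjc x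
  end.

Arguments of_real {R} k _.
Arguments re_part {R} k _.
Arguments sconj {R} k _.

(* The inner product is linear in its first argument and conjugate-linear in
   the second one. *)
Record hilbert (R : realType) (k : scalar_kind) := Hilbert {
  hspace :> completeNormedModType (scalars R k);
  hdot : {dot hspace for sconj k};
  hdot_norm : forall x : hspace, `|x| ^+ 2 = hdot x x
}.

Notation "''<' x , y >" := (hdot _ x y)
  (at level 0, x at level 69, y at level 69, format "''<' x ,  y >") : ring_scope.

Section BochnerIntegral.
Variables (R : realType) (k : scalar_kind) (V : normedModType (scalars R k)).
Implicit Types (a b : R) (f g : R -> V).

(* The norm of a [normedModType K] is K-valued; [rnorm] is the same norm, as an
   element of R. *)
Definition rnorm (x : V) : R := re_part k `|x|.

Definition is_simple g :=
  finite_set (range g) /\ forall y, measurable (g @^-1` [set y]).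

Definition simple_integral a b g : V :=
  \sum_(y \in range g)
    of_real k
      (fine (lebesgue_measure (`[a, b]%classic `&` g @^-1` [set y]))) *: y.

(* Measurability is Borel (as everywhere in the library) and the approximation
   is required at every point; every class of functions modulo almost
   everywhere equality has such a representative. *)
Definition strongly_measurable a b f :=
  exists2 g : nat -> R -> V, (forall n, is_simple (g n)) &
    forall s, s \in `[a, b] -> g n s @[n --> \oo] --> f s.

Definition is_bochner_integral a b f (v : V) :=
  strongly_measurable a b f /\
  exists g : nat -> R -> V,
  [/\ forall n, is_simple (g n),
      (\int[lebesgue_measure]_(s in `[a, b]) (rnorm (f s - g n s))%:E)%E
        @[n --> \oo] --> 0%E
    & simple_integral a b (g n) @[n --> \oo] --> v].

(* Equal to 0 when f is not Bochner integrable on [a, b]. *)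
Definition bochner a b f : V := xget 0 [set v | is_bochner_integral a b f v].

Definition L2 a b f :=
  strongly_measurable a b f /\
  (\int[lebesgue_measure]_(s in `[a, b]) (rnorm (f s) ^+ 2)%:E < +oo)%E.

End BochnerIntegral.

Section Operators.
Variables (R : realType) (k : scalar_kind).
Implicit Types (E F H : hilbert R k).

Definition bounded_linear E F (T : E -> F) :=
  linear T /\ exists c : R, forall x, rnorm (T x) <= c * rnorm x.

(* [adj T y] is the vector T^* y representing x |-> <T x, y>; it exists
   and is unique for bounded linear T. *)
Definition adj E F (T : E -> F) (y : F) : E :=
  xget 0 [set z : E | forall x, '<T x, y> = '<x, z> ].

Definition op_inv H (T : H -> H) : H -> H :=
  xget (fun=> 0) [set G : H -> H |
    [/\ bounded_linear G, cancel T G & cancel G T]].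

Definition self_adjoint H (T : H -> H) := forall x y, '<T x, y> = '<x, T y>.

Definition positive_op H (T : H -> H) :=
  [/\ bounded_linear T, self_adjoint T &
      forall phi : H, phi != 0 -> 0 < '<T phi, phi> ].

Definition C0_semigroup H (S : R -> H -> H) :=
  [/\ forall t, 0 <= t -> bounded_linear (S t),
      forall x, S 0 x = x,
      forall t s x, 0 <= t -> 0 <= s -> S (t + s) x = S t (S s x)
    & forall x, S t x @[t --> 0^'+] --> x].

(* The unbounded operator A has domain [D]; its values outside of [D] are
   irrelevant. *)
Definition infinitesimal_generator H (S : R -> H -> H)
    (D : set H) (A : H -> H) :=
  forall x y, (D x /\ A x = y) <->
    of_real k h^-1 *: (S h x - x) @[h --> 0^'+] --> y.

Definition strongly_to0 H (T : R -> H -> H) :=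
  forall x, T e x @[e --> 0^'+] --> (0 : H).

Definition weakly_to0 H (T : R -> H -> H) :=
  forall x y, ('<T e x, y> : (scalars R k)^o) @[e --> 0^'+]
                --> (0 : (scalars R k)^o).

End Operators.

(* Only [sC k], [sD k] for 1 <= k <= p and [st k] for k <= p + 1 are used;
   likewise [sS t] for t >= 0. *)
Record impulsive_system (R : realType) (k : scalar_kind) (H U : hilbert R k) :=
  ImpulsiveSystem {
  sp : nat;
  sb : R;
  st : nat -> R;
  sdomA : set H;
  sA : H -> H;
  sS : R -> H -> H;
  sB : U -> H;
  sC : nat -> H -> H;
  sD : nat -> U -> H;
  sp_ge1 : (1 <= sp)%N;
  sb_gt0 : 0 < sb;
  st_first : st 0 = 0;
  st_last : st sp.+1 = sb;
  st_lt : forall i, (i <= sp)%N -> st i < st i.+1;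
  sS_C0 : C0_semigroup sS;
  sA_generator : infinitesimal_generator sS sdomA sA;
  sB_bounded : bounded_linear sB;
  sC_bounded : forall i, (1 <= i <= sp)%N -> bounded_linear (sC i);
  sD_bounded : forall i, (1 <= i <= sp)%N -> bounded_linear (sD i)
}.

Section System.
Variables (R : realType) (k : scalar_kind) (H U : hilbert R k).
Variable sys : impulsive_system H U.

Local Notation p := (sp sys).
Local Notation b := (sb sys).
Local Notation t := (st sys).
Local Notation S := (sS sys).
Local Notation B := (sB sys).
Local Notation C := (sC sys).
Local Notation D := (sD sys).

(* Elements of L^2([0,b], U) x U^p are represented by pairs (u, v) satisfying
   [is_control]; u is taken modulo almost everywhere equality on [0, b], and
   only v_1, ..., v_p matter, so [control_eq0] is the zero class. *)
Definition control : Type := ((R -> U) * (nat -> U))%type.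

Definition is_control (w : control) := L2 0 b w.1.

Definition control_eq0 (w : control) :=
  {ae lebesgue_measure, forall s, s \in `[0, b] -> w.1 s = 0} /\
  forall i, (1 <= i <= p)%N -> w.2 i = 0.

Definition control_dot (w1 w2 : control) : scalars R k :=
  bochner (V := (scalars R k)^o) 0 b (fun s => '<w1.1 s, w2.1 s>)
  + \sum_(1 <= i < p.+1) '<w1.2 i, w2.2 i>.

(* Left continuity, x(t_k^-) = x(t_k), is built in: x is given on the intervals
   ]t_k, t_(k+1)], and x(t_k^+) = (I + C_k) x(t_k) + D_k v_k. *)
Definition mild_solution (x0 : H) (w : control) (x : R -> H) :=
  (forall r, 0 <= r <= t 1 ->
     x r = S r x0 + bochner 0 r (fun s => S (r - s) (B (w.1 s)))) /\
  (forall i, (1 <= i <= p)%N -> forall r, t i < r <= t i.+1 ->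
     x r = S (r - t i) (x (t i) + C i (x (t i)) + D i (w.2 i))
           + bochner (t i) r (fun s => S (r - s) (B (w.1 s)))).

Definition approximately_controllable :=
  forall (x0 h : H) (delta : R), 0 < delta ->
    exists w x,
      [/\ is_control w, mild_solution x0 w x & rnorm (x b - h) < delta].

Definition SC (i : nat) (s : R) (x : H) : H :=
  S (t i - s) x + C i (S (t i - s) x).

Definition SCadj (i : nat) (s : R) (x : H) : H :=
  adj (S (t i - s)) (x + adj (C i) x).

(* S_C(t_p, t_(p-1)) \o ... \o S_C(t_i, t_(i-1)) *)
Definition prodSC (i : nat) : H -> H :=
  \big[(fun f g : H -> H => f \o g)/id]_(j <- rev (index_iota i p.+1))
    SC j (t j.-1).

(* S_C^*(t_i, t_(i-1)) \o ... \o S_C^*(t_p, t_(p-1)) *)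
Definition prodSCadj (i : nat) : H -> H :=
  \big[(fun f g : H -> H => f \o g)/id]_(j <- index_iota i p.+1)
    SCadj j (t j.-1).

Definition Mop (w : control) : H :=
  S (b - t p) (\sum_(1 <= i < p.+1)
     prodSC i.+1 (bochner (t i.-1) (t i) (fun s => SC i s (B (w.1 s)))))
  + bochner (t p) b (fun s => S (b - s) (B (w.1 s)))
  + S (b - t p) (\sum_(2 <= i < p.+1) prodSC i (D i.-1 (w.2 i.-1)))
  + S (b - t p) (D p (w.2 p)).

Definition Mop_adj (phi : H) : control :=
  xget (fun=> 0, fun=> 0) [set w | is_control w /\
    forall w', is_control w' -> '<Mop w', phi> = control_dot w' w].

Definition Gamma (phi : H) : H :=
  bochner (t p) b (fun s => S (b - s) (B (adj B (adj (S (b - s)) phi)))).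

Definition Gamma_tilde (phi : H) : H :=
  S (b - t p) (D p (adj (D p) (adj (S (b - t p)) phi))).

Definition Theta (phi : H) : H :=
  S (b - t p) (\sum_(1 <= i < p.+1)
    prodSC i.+1 (bochner (t i.-1) (t i) (fun s =>
      SC i s (B (adj B (SCadj i s
        (prodSCadj i.+1 (adj (S (b - t p)) phi)))))))).

Definition Theta_tilde (phi : H) : H :=
  S (b - t p) (\sum_(2 <= i < p.+1)
    prodSC i (D i.-1 (adj (D i.-1)
      (prodSCadj i (adj (S (b - t p)) phi))))).

Definition controllability_op (phi : H) : H :=
  Theta phi + Gamma phi + Theta_tilde phi + Gamma_tilde phi.

(* e (e I + Theta + Gamma + Theta~ + Gamma~)^-1 *)
Definition scaled_resolvent (e : R) (x : H) : H :=
  of_real k e *: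
    op_inv (fun y => of_real k e *: y + controllability_op y) x.

End System.

(* Main.v *)
From HB Require Import structures.
From mathcomp Require Import all_boot all_order all_algebra.
From mathcomp Require Import complex sesquilinear ring lra.
From mathcomp Require Import all_classical all_reals all_analysis.
From mathcomp Require Import measurable_realfun.
Require Import Defs.

Set Implicit Arguments.
Unset Strict Implicit.
Unset Printing Implicit Defensive.

Import Order.TTheory GRing.Theory Num.Theory.
Import numFieldNormedType.Exports.
Import HBNNSimple.

Local Open Scope classical_set_scope.
Local Open Scope ring_scope.

(** Write T for the sum of the four operators in condition (c).

    Unrolling the jumps of a mild solution gives x(b) = L x_0 + M w, where L
    does not depend on the control [mild_solution_endpoint]; every control has
    a mild solution, so (a) says that the range of M is dense.  Moving the
    operators of M one by one to the other side of the inner product identifies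
    M^* phi with an explicit control, B^* S_C^*(t_i, s) xi_(i+1) on
    ]t_(i-1), t_i] together with the impulses D_i^* xi_(i+1), where
    xi_i = S_C^*(t_i, t_(i-1)) ... S_C^*(t_p, t_(p-1)) S^*(b - t_p) phi
    [optimal_control, hdot_Mop].  Substituting this control in M gives
    T = M M^* [controllability_op_Mop].  Hence <T phi, psi> is the inner product
    of M^* phi and M^* psi: T is self-adjoint and nonnegative, and
    <T phi, phi> = 0 exactly when M^* phi is the zero class.

    - (a) implies (b): M^* phi = 0 makes phi orthogonal to a dense range.
    - (b) implies (c): this is the last remark.
    - (c) implies (d): the operators e (e + T)^-1 have norm at most 1, and
      e (e + T)^-1 T y = e y - e (e (e + T)^-1 y) has norm at most 2 e |y|; the
      range of T is dense because T is self-adjoint and injective.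
    - (d) implies (e) by the Cauchy-Schwarz inequality.
    - (e) implies (a): if T x = 0 then e (e + T)^-1 x = x, which tends weakly
      to 0, so x = 0 and T has a dense range; T y = M (M^* y) is reached, up to
      L x_0, by the control M^* y.

    Two analytic facts support this.  The Bochner integral of an integrable
    function f is characterised by <int f, y> = int <f, y> for all y
    [bochner_rdot], which reduces its properties to those of the Lebesgue
    integral of real functions; in particular it commutes with bounded operators.
    The control M^* phi must be strongly measurable; this holds because the
    adjoints of a strongly continuous semigroup on a Hilbert space are again
    strongly continuous [adj_semigroup_C0].

    Real and complex scalars are treated together through the real inner product
    Re <x, y>, which determines <x, y> because <c x, y> = c <x, y>. *)

(** * Real and complex scalars *)

Section Scalars.
Variables (R : realType) (k : scalar_kind).
Local Notation K := (scalars R k).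
Local Notation re := (re_part k).
Implicit Types (z w : K) (r s : R).

Lemma re_partD z w : re (z + w) = re z + re w.
Proof. by case: k z w => // -[a b] [c d]. Qed.

Lemma re_partN z : re (- z) = - re z.
Proof. by case: k z => // -[a b]. Qed.

Lemma re_part_of_real r : re (of_real k r) = r.
Proof. by case: k. Qed.

Lemma of_realD r s : of_real k (r + s) = of_real k r + of_real k s.
Proof. by case: k => //=; rewrite rmorphD. Qed.

Lemma of_realM r s : of_real k (r * s) = of_real k r * of_real k s.
Proof. by case: k => //=; rewrite rmorphM. Qed.

Lemma of_real0 : of_real k 0 = 0 :> K.
Proof. by case: k. Qed.

Lemma of_real1 : of_real k 1 = 1 :> K.
Proof. by case: k. Qed.

Lemma of_realN r : of_real k (- r) = - of_real k r.
Proof. by case: k => //=; rewrite rmorphN. Qed.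

Lemma re_part0 : re (0 : K) = 0.
Proof. by case: k. Qed.

Lemma re_partZ r z : re (of_real k r * z) = r * re z.
Proof. by case: k z => //= -[a b] /=; rewrite mul0r subr0. Qed.

Lemma re_part_conj z : re (sconj k z) = re z.
Proof. by case: k z => // -[a b]. Qed.

Lemma sconjK : involutive (sconj k : K -> K).
Proof. by case: k => // -[a b] /=; rewrite opprK. Qed.

Lemma sconjD z w : sconj k (z + w) = sconj k z + sconj k w.
Proof. by case: k z w => //= z w; rewrite rmorphD. Qed.

Lemma sconjB z w : sconj k (z - w) = sconj k z - sconj k w.
Proof. by case: k z w => //= z w; rewrite rmorphB. Qed.

Lemma sconj0 : sconj k 0 = 0 :> K.
Proof. by have := sconjB 0 0; rewrite !subrr. Qed.

Lemma sconjM z w : sconj k (z * w) = sconj k z * sconj k w.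
Proof. by case: k z w => //= z w; rewrite rmorphM. Qed.

Lemma of_real_le r s : (of_real k r <= of_real k s) = (r <= s).
Proof. by case: k => //=; rewrite lecR. Qed.

Lemma of_real_lt r s : (of_real k r < of_real k s) = (r < s).
Proof. by case: k => //=; rewrite ltcR. Qed.

Lemma ge0_of_real z : 0 <= z -> z = of_real k (re z).
Proof.
by case: k z => //= -[a b]; rewrite lecE /= => /andP[/eqP -> _].
Qed.

(** Testing against c = 1 and c = -i recovers both coordinates. *)
Lemma re_part_ext z w : (forall c, re (c * z) = re (c * w)) -> z = w.
Proof.
case: k z w => [|[a b] [c d]] /=; first by move=> z w /(_ 1); rewrite !mul1r.
move=> h; have := h 1; rewrite !mul1r /= => ->.
by have /= := h (Complex 0 (-1)); rewrite !mul0r !mulN1r !opprK !add0r => ->.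
Qed.

Lemma sconj_fixed z : sconj k z = z -> z = of_real k (re z).
Proof.
case: k z => // -[a b] /= [] /eqP; rewrite eq_sym -addr_eq0 -mulr2n mulrn_eq0 /=.
by move=> /eqP ->.
Qed.

Lemma re_part_norm_complex (a b : R) :
  re_part ComplexScalars (`|(Complex a b : scalars R ComplexScalars)|) =
  Num.sqrt (a ^+ 2 + b ^+ 2).
Proof. by have -> := normc_def (Complex a b). Qed.

Lemma ler_norm_re_part z : `|re z| <= re `|z|.
Proof.
case: k z => // -[a b]; rewrite re_part_norm_complex /=.
by rewrite -sqrtr_sqr ler_wsqrtr// lerDl sqr_ge0.
Qed.

Lemma re_part_norm_conj z : re `|sconj k z| = re `|z|.
Proof. by case: k z => // -[a b]; rewrite !re_part_norm_complex sqrrN. Qed.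

Lemma norm_of_real r : `|of_real k r| = of_real k `|r|.
Proof.
rewrite [LHS]ge0_of_real ?normr_ge0//; congr of_real.
by case: k => //; rewrite re_part_norm_complex expr0n /= addr0 sqrtr_sqr.
Qed.

End Scalars.

(** * The real norm and the real inner product *)

Section RealNorm.
Variables (R : realType) (k : scalar_kind) (V : normedModType (scalars R k)).
Local Notation K := (scalars R k).
Local Notation re := (re_part k).
Implicit Types (x y : V) (r : R).

Lemma norm_rnorm x : `|x| = of_real k (rnorm x).
Proof. exact/ge0_of_real/normr_ge0. Qed.

Lemma rnorm_ge0 x : 0 <= rnorm x.
Proof. by rewrite -(@of_real_le R k) of_real0 -norm_rnorm. Qed.

Lemma rnorm0 : rnorm (0 : V) = 0.
Proof. by rewrite /rnorm normr0; case: k. Qed.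

Lemma rnorm_eq0 x : rnorm x = 0 -> x = 0.
Proof. by move=> x0; apply/normr0_eq0; rewrite norm_rnorm x0 of_real0. Qed.

Lemma rnormN x : rnorm (- x) = rnorm x.
Proof. by rewrite /rnorm normrN. Qed.

Lemma rdistC x y : rnorm (x - y) = rnorm (y - x).
Proof. by rewrite /rnorm distrC. Qed.

Lemma ler_rnormD x y : rnorm (x + y) <= rnorm x + rnorm y.
Proof.
by rewrite -(@of_real_le R k) of_realD -!norm_rnorm ler_normD.
Qed.

Lemma ler_rdistD y x z : rnorm (x - z) <= rnorm (x - y) + rnorm (y - z).
Proof. by rewrite -[x - z](subrKA y) ler_rnormD. Qed.

Lemma rnormZ (c : K) x : rnorm (c *: x) = re `|c| * rnorm x.
Proof.
by rewrite /rnorm normrZ [`|c|]ge0_of_real// re_partZ re_part_of_real.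
Qed.

Lemma rnormZr r x : rnorm (of_real k r *: x) = `|r| * rnorm x.
Proof. by rewrite rnormZ norm_of_real re_part_of_real. Qed.

Lemma cvg_rnormP T (F : set_system T) {FF : Filter F} (f : T -> V) x :
  f @ F --> x <->
  forall e : R, 0 < e -> \forall t \near F, rnorm (x - f t) < e.
Proof.
rewrite cvgrPdist_lt; split=> fx e e0.
  have := fx (of_real k e).
  rewrite -[X in X < _](of_real0 R) of_real_lt => /(_ e0).
  by apply: filterS => t; rewrite norm_rnorm of_real_lt.
have eE := ge0_of_real (ltW e0).
move: e0; rewrite eE -[X in X < _](of_real0 R) of_real_lt => e0.
by apply: filterS (fx _ e0) => t; rewrite norm_rnorm of_real_lt.
Qed.

Lemma cvg_rnorm0 T (F : set_system T) {FF : Filter F} (f : T -> V) x :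
  f @ F --> x <-> rnorm (x - f t) @[t --> F] --> 0.
Proof.
rewrite cvg_rnormP cvgrPdist_lt; split=> fx e /fx; apply: filterS => t;
  by rewrite sub0r normrN ger0_norm ?rnorm_ge0.
Qed.

End RealNorm.

Lemma mul_sconj (R : realType) (k : scalar_kind) (z : scalars R k) :
  z * sconj k z = of_real k (rnorm (z : (scalars R k)^o) ^+ 2).
Proof.
have -> : z * sconj k z = `|z| ^+ 2.
  by case: k z => z; [rewrite real_normK ?num_real ?expr2|rewrite normCK].
by rewrite (norm_rnorm (z : (scalars R k)^o)) !expr2 of_realM.
Qed.

Section RealInnerProduct.
Variables (R : realType) (k : scalar_kind) (H : hilbert R k).
Local Notation K := (scalars R k).
Local Notation re := (re_part k).
Implicit Types (x y z : H) (r s : R) (c : K).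

Definition rdot x y : R := re '<x, y>.

Lemma hdotDl x y z : '<x + y, z> = '<x, z> + '<y, z>.
Proof. exact: linearDl. Qed.

Lemma hdotZl c x y : '<c *: x, y> = c * '<x, y>.
Proof. exact: linearZl_LR. Qed.

Lemma hdotC x y : '<x, y> = sconj k '<y, x>.
Proof. by rewrite [LHS]hermitian_subproof expr0 mul1r. Qed.

Lemma hdotZr c x y : '<x, c *: y> = sconj k c * '<x, y>.
Proof. by rewrite hdotC hdotZl sconjM -hdotC. Qed.

Lemma hdotBl x y z : '<x - y, z> = '<x, z> - '<y, z>.
Proof. exact: linearBl. Qed.

Lemma hdotBr x y z : '<x, y - z> = '<x, y> - '<x, z>.
Proof. by rewrite hdotC hdotBl sconjB -!hdotC. Qed.

Lemma hdot0l x : '<0, x> = 0.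
Proof. by have := hdotBl 0 0 x; rewrite !subrr. Qed.

Lemma hdot0r x : '<x, 0> = 0.
Proof. by have := hdotBr x 0 0; rewrite !subrr. Qed.

Lemma rdotDl x y z : rdot (x + y) z = rdot x z + rdot y z.
Proof. by rewrite /rdot hdotDl re_partD. Qed.

Lemma rdotC x y : rdot x y = rdot y x.
Proof. by rewrite /rdot hdotC re_part_conj. Qed.

Lemma rdotDr x y z : rdot x (y + z) = rdot x y + rdot x z.
Proof. by rewrite rdotC rdotDl !(rdotC x). Qed.

Lemma rdotNl x y : rdot (- x) y = - rdot x y.
Proof. by rewrite /rdot linearNl re_partN. Qed.

Lemma rdotNr x y : rdot x (- y) = - rdot x y.
Proof. by rewrite rdotC rdotNl rdotC. Qed.

Lemma rdotBl x y z : rdot (x - y) z = rdot x z - rdot y z.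
Proof. by rewrite rdotDl rdotNl. Qed.

Lemma rdotBr x y z : rdot x (y - z) = rdot x y - rdot x z.
Proof. by rewrite rdotDr rdotNr. Qed.

Lemma rdotZl r x y : rdot (of_real k r *: x) y = r * rdot x y.
Proof. by rewrite /rdot hdotZl re_partZ. Qed.

Lemma rdotZr r x y : rdot x (of_real k r *: y) = r * rdot x y.
Proof. by rewrite rdotC rdotZl rdotC. Qed.

Lemma rdot0l x : rdot 0 x = 0.
Proof. by rewrite -(subrr 0) rdotBl subrr. Qed.

Lemma rdot0r x : rdot x 0 = 0.
Proof. by rewrite rdotC rdot0l. Qed.

Lemma hdotxx x : '<x, x> = of_real k (rnorm x ^+ 2).
Proof. by rewrite -hdot_norm norm_rnorm !expr2 of_realM. Qed.

Lemma rdotxx x : rdot x x = rnorm x ^+ 2.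
Proof. by rewrite /rdot hdotxx re_part_of_real. Qed.

Lemma rdotxx_eq0 x : rdot x x = 0 -> x = 0.
Proof. by rewrite rdotxx => /eqP; rewrite sqrf_eq0 => /eqP /rnorm_eq0. Qed.

Lemma rdot_ext x y : (forall z, rdot x z = rdot y z) -> x = y.
Proof.
by move=> xy; apply/subr0_eq/rdotxx_eq0; rewrite rdotBl xy subrr.
Qed.

Lemma rnormD2 x y :
  rnorm (x + y) ^+ 2 = rnorm x ^+ 2 + 2 * rdot x y + rnorm y ^+ 2.
Proof. by rewrite -!rdotxx rdotDl !rdotDr (rdotC y x); ring. Qed.

Lemma rnormB2 x y :
  rnorm (x - y) ^+ 2 = rnorm x ^+ 2 - 2 * rdot x y + rnorm y ^+ 2.
Proof. by rewrite rnormD2 rdotNr rnormN; ring. Qed.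

(** Cauchy-Schwarz, from the square of the norm of |y| x - |x| y. *)
Lemma rdot_le x y : rdot x y <= rnorm x * rnorm y.
Proof.
have [x0|x0] := eqVneq (rnorm x) 0.
  by rewrite (rnorm_eq0 x0) rdot0l rnorm0 mul0r.
have [y0|y0] := eqVneq (rnorm y) 0.
  by rewrite (rnorm_eq0 y0) rdot0r rnorm0 mulr0.
have x_gt0 : 0 < rnorm x by rewrite lt_def x0 rnorm_ge0.
have y_gt0 : 0 < rnorm y by rewrite lt_def y0 rnorm_ge0.
have := sqr_ge0 (rnorm (of_real k (rnorm y) *: x - of_real k (rnorm x) *: y)).
rewrite rnormB2 !rnormZr rdotZl rdotZr !gtr0_norm// => h.
have {h} : 0 <= 2 * (rnorm x * rnorm y) * (rnorm x * rnorm y - rdot x y).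
  by apply: le_trans h _; rewrite le_eqVlt; apply/orP; left; apply/eqP; ring.
by rewrite pmulr_rge0 ?subr_ge0// !mulr_gt0.
Qed.

Lemma norm_rdot_le x y : `|rdot x y| <= rnorm x * rnorm y.
Proof.
rewrite ler_norml rdot_le andbT lerNl -rdotNl.
by apply: le_trans (rdot_le _ _) _; rewrite rnormN.
Qed.

Lemma rnorm_le_rdot x (c : R) : 0 <= c ->
  (forall y, rdot x y <= c * rnorm y) -> rnorm x <= c.
Proof.
move=> c0 /(_ x); rewrite rdotxx expr2.
have [->//|x0] := eqVneq (rnorm x) 0.
by rewrite ler_pM2r// lt_def x0 rnorm_ge0.
Qed.

Lemma re_part_hdot c x y : re (c * '<x, y>) = rdot (c *: x) y.
Proof. by rewrite /rdot hdotZl. Qed.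

Lemma rdotZC c x y : rdot (c *: x) y = rdot x (sconj k c *: y).
Proof. by rewrite /rdot hdotZl hdotZr sconjK. Qed.

(** For z = <x, y>, |z|^2 = Re (conj z <x, y>) = Re <conj z x, y>, so the bound
    follows from the one on the real inner product. *)
Lemma norm_hdot_le x y : rnorm ('<x, y> : K^o) <= rnorm x * rnorm y.
Proof.
set z := '<x, y>.
have [z0|z0] := eqVneq (rnorm (z : K^o)) 0.
  by rewrite z0 mulr_ge0 ?rnorm_ge0.
have z_gt0 : 0 < rnorm (z : K^o) by rewrite lt_def z0 rnorm_ge0.
rewrite -(ler_pM2l z_gt0) -expr2 -(re_part_of_real k (_ ^+ 2)) -mul_sconj mulrC.
rewrite re_part_hdot; apply: le_trans (rdot_le _ _) _.
by rewrite rnormZ re_part_norm_conj mulrA.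
Qed.

End RealInnerProduct.

Lemma hdot_ext (R : realType) (k : scalar_kind) (H H' : hilbert R k)
    (x y : H) (x' y' : H') :
  (forall c : scalars R k, rdot (c *: x) y = rdot (c *: x') y') ->
  '<x, y> = '<x', y'>.
Proof. by move=> h; apply: re_part_ext => c; rewrite !re_part_hdot h. Qed.

(** * Orthogonal projection and the Riesz representation *)

Section Projection.
Variables (R : realType) (k : scalar_kind) (H : hilbert R k).
Implicit Types (x y z v w : H) (r : R) (W : set H).

Lemma rnorm_complete (u : nat -> H) :
    (forall e : R, 0 < e -> exists N, forall n m, (N <= n)%N -> (N <= m)%N ->
      rnorm (u n - u m) < e) ->
  exists l : H, u @ \oo --> l.
Proof.
move=> cu; suff: cvg (u @ \oo) by move=> /cvg_ex[l ul]; exists l.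
apply/cauchy_cvgP/cauchy_ballP => e e0.
have eE := ge0_of_real (ltW e0).
move: e0; rewrite eE -[X in X < _](of_real0 R) of_real_lt => e0.
have [N hN] := cu _ e0.
exists (u @` [set n | (N <= n)%N], u @` [set n | (N <= n)%N]) => /=.
  by split; exists N => // n Nn; exists n.
move=> [_ _] [/= [n Nn <-] [m Nm <-]].
by rewrite -ball_normE /= norm_rnorm of_real_lt; apply: hN.
Qed.

(** Subspaces over the reals, because the null space of a real-linear functional
    on a complex space need not be a complex subspace. *)
Definition real_subspace W :=
  [/\ W 0, forall x y, W x -> W y -> W (x + y)
    & forall r x, W x -> W (of_real k r *: x)].

Definition adherent W x := forall e : R, 0 < e -> exists2 y, W y & rnorm (x - y) < e.

Lemma cvg_rnorm_lt (u : nat -> H) x (e : R) : u @ \oo --> x -> 0 < e ->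
  exists N, forall n, (N <= n)%N -> rnorm (x - u n) < e.
Proof. by move=> /cvg_rnormP ux /ux[N _ hN]; exists N => n /hN. Qed.

(** The parallelogram law: two almost nearest points v and w of x are close to
    each other when their midpoint is at distance at least d from x. *)
Lemma parallelogram_diff x v w (d e : R) : 0 <= d -> 0 < e -> e <= 1 ->
    rnorm (x - v) < d + e -> rnorm (x - w) < d + e ->
    d <= rnorm (x - of_real k 2^-1 *: (v + w)) ->
  rnorm (v - w) ^+ 2 <= 4 * (2 * d + 1) * e.
Proof.
move=> d0 e0 e1 xv xw xm.
set a := x - v; set b := x - w.
have vw : v - w = b - a by rewrite opprB [RHS]addrC subrKA.
have mE : x - of_real k 2^-1 *: (v + w) = of_real k 2^-1 *: (a + b).
  rewrite /a /b addrACA -opprD scalerBr; congr (_ - _).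
  by rewrite scalerDr -scalerDl -of_realD (_ : 2^-1 + 2^-1 = 1) ?of_real1 ?scale1r//; field.
rewrite mE in xm.
have h1 : d ^+ 2 <= 4^-1 * rnorm (a + b) ^+ 2.
  apply: le_trans (_ : rnorm (of_real k 2^-1 *: (a + b)) ^+ 2 <= _).
    by rewrite ler_sqr ?nnegrE ?rnorm_ge0.
  rewrite rnormZr gtr0_norm ?invr_gt0// exprMn exprVn.
  by rewrite (_ : 2 ^+ 2 = 4 :> R)//; ring.
have h2 : rnorm a ^+ 2 <= (d + e) ^+ 2.
  by rewrite ler_sqr ?nnegrE ?rnorm_ge0 ?addr_ge0// ltW.
have h3 : rnorm b ^+ 2 <= (d + e) ^+ 2.
  by rewrite ler_sqr ?nnegrE ?rnorm_ge0 ?addr_ge0// ltW.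
rewrite vw rnormB2 (rdotC b); move: h1; rewrite rnormD2 => h1.
have h4 : e * e <= e by rewrite ler_piMr// ltW.
nra.
Qed.

(** A minimising sequence is Cauchy by [parallelogram_diff]. *)
Lemma nearest_point W x : real_subspace W -> adherent W `<=` W ->
  exists2 w, W w & forall v, W v -> rnorm (x - w) <= rnorm (x - v).
Proof.
move=> sW cW.
pose D := [set rnorm (x - v) | v in W].
have W0 : W 0 by case: sW.
have D0 : D !=set0 by exists (rnorm (x - 0)); exists 0.
have lbD : lbound D 0 by move=> _ [v _ <-]; exact: rnorm_ge0.
have hlbD : has_lbound D by exists 0.
pose d := inf D.
have d0 : 0 <= d by exact: lb_le_inf.
have dle v : W v -> d <= rnorm (x - v) by move=> Wv; apply: ge_inf => //; exists v.
have /choice[v vP] : forall n : nat,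
    exists v, W v /\ rnorm (x - v) < d + n.+1%:R^-1.
  move=> n; have : has_inf D by [].
  move=> /(inf_adherent (eps := n.+1%:R^-1)) []; first by rewrite invr_gt0.
  by move=> _ [v Wv <-] h; exists v.
have Wm n m : W (of_real k 2^-1 *: (v n + v m)).
  by case: sW => _ WD WZ; apply/WZ/WD; [case: (vP n)|case: (vP m)].
have small (e : R) : 0 < e -> exists N : nat, forall n, (N <= n)%N ->
    n.+1%:R^-1 < e.
  move=> /ltr_add_invr[N]; rewrite add0r => Ne; exists N => n Nn.
  by apply: le_lt_trans Ne; rewrite lef_pV2 ?posrE// ler_nat.
have inv1 n : n.+1%:R^-1 <= 1 :> R by rewrite invf_le1 ?ler1n.
have [|w vw] := @rnorm_complete v.
  move=> e e0; have c0 : 0 < 4 * (2 * d + 1) by rewrite mulr_gt0// ltr_wpDl// mulr_ge0.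
  have [|N hN] := small (e ^+ 2 / (4 * (2 * d + 1))).
    by rewrite divr_gt0 ?exprn_gt0.
  exists N => n m Nn Nm.
  rewrite -ltr_sqr ?nnegrE ?rnorm_ge0 ?(ltW e0)//.
  apply: le_lt_trans (parallelogram_diff d0 (_ : 0 < N.+1%:R^-1) (inv1 N)
    _ _ (dle _ (Wm n m))) _.
  - by rewrite invr_gt0.
  - by apply: lt_le_trans (vP n).2 _; rewrite lerD2l lef_pV2 ?posrE// ler_nat.
  - by apply: lt_le_trans (vP m).2 _; rewrite lerD2l lef_pV2 ?posrE// ler_nat.
  - by rewrite mulrC -ltr_pdivlMr// hN.
exists w => [|u Wu].
  apply: cW => e e0; have [N hN] := cvg_rnorm_lt vw e0.
  by exists (v N); [case: (vP N)|exact: hN].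
apply/ler_addgt0Pr => e e0.
have e20 : 0 < e / 2 by rewrite divr_gt0.
have [N hN] := cvg_rnorm_lt vw e20; have [M hM] := small _ e20.
pose n := maxn N M.
apply: le_trans (ler_rdistD (v n) _ _) _.
have := hM n (leq_maxr _ _); have := hN n (leq_maxl _ _).
have := (vP n).2; have := dle _ Wu.
rewrite (rdistC (v n)) -/n; set q := n.+1%:R^-1; lra.
Qed.

(** Otherwise moving the nearest point w along v by <x - w, v> / |v|^2 would
    decrease the distance to x. *)
Lemma orthogonal_projection W x : real_subspace W -> adherent W `<=` W ->
  exists2 w, W w & forall v, W v -> rdot (x - w) v = 0.
Proof.
move=> sW cW; have [w Ww hw] := nearest_point x sW cW; exists w => // v Wv.
have [v0|v0] := eqVneq (rnorm v) 0; first by rewrite (rnorm_eq0 v0) rdot0r.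
have v_gt0 : 0 < rnorm v ^+ 2 by rewrite exprn_gt0// lt_def v0 rnorm_ge0.
set c := rdot (x - w) v.
have := hw (w + of_real k (c / rnorm v ^+ 2) *: v).
case: (sW) => _ WD WZ => /(_ (WD _ _ Ww (WZ _ _ Wv))).
rewrite -ler_sqr ?nnegrE ?rnorm_ge0// opprD addrA (rnormB2 (x - w)) rdotZr -/c rnormZr.
rewrite exprMn real_normK ?num_real//.
set n := rnorm v ^+ 2 in v_gt0 *.
have -> : (c / n) ^+ 2 * n = c ^+ 2 / n by field; rewrite lt0r_neq0.
rewrite mulrAC -expr2 => h.
have : c ^+ 2 / n <= 0 by lra.
rewrite pmulr_lle0 ?invr_gt0// => c2.
by apply/eqP; rewrite -sqrf_eq0 eq_le c2 sqr_ge0.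
Qed.

(** The representing vector is a multiple of the component y, orthogonal to the
    null space of f, of any x0 with f x0 <> 0; the factor is forced by the value
    at y. *)
Lemma riesz (f : H -> R) (c : R) :
    (forall x y, f (x + y) = f x + f y) ->
    (forall r x, f (of_real k r *: x) = r * f x) ->
    (forall x, `|f x| <= c * rnorm x) ->
  exists z, forall x, f x = rdot x z.
Proof.
move=> fD fZ fb.
have f0 : f 0 = 0 by rewrite -(scale0r 0) -(of_real0 R) fZ mul0r.
have fB x y : f (x - y) = f x - f y.
  by rewrite fD -[- y]scaleN1r -(of_real1 R) -of_realN fZ mulN1r.
pose W := [set x | f x = 0].
have sW : real_subspace W.
  split => // [x y|r x]; rewrite /W /= ?fD ?fZ => ->; last by rewrite mulr0.
  by move=> ->; rewrite addr0.
have cW : adherent W `<=` W.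
  move=> x hx; rewrite /W /=; apply/eqP; rewrite -normr_le0.
  apply/ler_addgt0Pr => e e0; rewrite add0r.
  pose c' := `|c| + 1.
  have c'0 : 0 < c' by rewrite ltr_wpDl.
  have [y Wy /ltW xy] := hx (e / c') (divr_gt0 e0 c'0).
  have -> : f x = f (x - y) by rewrite fB Wy subr0.
  apply: le_trans (fb _) _.
  apply: le_trans (_ : c' * rnorm (x - y) <= _).
    by rewrite ler_wpM2r ?rnorm_ge0// ler_wpDr// ler_norm.
  by rewrite mulrC -ler_pdivlMr.
have [fz|/existsNP[x0 fx0]] := pselect (forall x, f x = 0).
  by exists 0 => x; rewrite rdot0r fz.
have [w Ww hw] := orthogonal_projection x0 sW cW.
pose y := x0 - w.
have fy : f y = f x0 by rewrite fB Ww subr0.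
have y0 : rnorm y != 0.
  apply/eqP => /rnorm_eq0 y0; apply: fx0.
  by rewrite -fy y0.
have fy0 : f y != 0 by rewrite fy; apply/eqP.
exists (of_real k (f y / rnorm y ^+ 2) *: y) => x.
have /hw : W (x - of_real k (f x / f y) *: y).
  by rewrite /W /= fB fZ divfK ?subrr.
rewrite -/y rdotBr rdotZr rdotxx => /subr0_eq xy.
by rewrite rdotZr (rdotC x) xy; field; rewrite y0 fy0.
Qed.

End Projection.

(** * Bounded operators and their adjoints *)

Section BoundedLinear.
Variables (R : realType) (k : scalar_kind).
Local Notation K := (scalars R k).
Implicit Types (E F G : hilbert R k).

Section OneOperator.
Variables (E F : hilbert R k) (T : E -> F).
Hypothesis bT : bounded_linear T.

Lemma bounded_linearD x y : T (x + y) = T x + T y.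
Proof. by case: bT => lT _; have := lT 1 x y; rewrite !scale1r. Qed.

Lemma bounded_linear0 : T 0 = 0.
Proof. by apply: (addrI (T 0)); rewrite -bounded_linearD !addr0. Qed.

Lemma bounded_linearZ c x : T (c *: x) = c *: T x.
Proof. by case: bT => lT _; have := lT c x 0; rewrite bounded_linear0 !addr0. Qed.

Lemma bounded_linearN x : T (- x) = - T x.
Proof. by rewrite -scaleN1r bounded_linearZ scaleN1r. Qed.

Lemma bounded_linearB x y : T (x - y) = T x - T y.
Proof. by rewrite bounded_linearD bounded_linearN. Qed.

Lemma bounded_linear_sum I (r : seq I) (P : pred I) (f : I -> E) :
  T (\sum_(i <- r | P i) f i) = \sum_(i <- r | P i) T (f i).
Proof. exact: (big_morph T bounded_linearD bounded_linear0). Qed.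

Lemma bounded_linear_bound : exists2 c : R, 0 < c & forall x, rnorm (T x) <= c * rnorm x.
Proof.
case: bT => _ [c hc]; exists (`|c| + 1) => [|x]; first by rewrite ltr_wpDl.
by apply: le_trans (hc x) _; rewrite ler_wpM2r ?rnorm_ge0// ler_wpDr// ler_norm.
Qed.

(** Riesz represents the real functional x |-> Re <T x, y>; applying this to
    c x for all scalars c gives the identity of the full inner products. *)
Lemma adjP x y : '<T x, y> = '<x, adj T y>.
Proof.
suff /(xgetPex 0)/(_ x) : exists z, forall x, '<T x, y> = '<x, z> by [].
have [c c0 hc] := bounded_linear_bound.
have [||x'|z hz] := @riesz _ _ E (fun x => rdot (T x) y) (c * rnorm y).
- by move=> x1 x2; rewrite bounded_linearD rdotDl.
- by move=> r x1; rewrite bounded_linearZ rdotZl.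
- apply: le_trans (norm_rdot_le _ _) _.
  by rewrite mulrAC ler_wpM2r ?rnorm_ge0.
by exists z => x'; apply: hdot_ext => a; rewrite -bounded_linearZ hz.
Qed.

Lemma rdot_adj x y : rdot (T x) y = rdot x (adj T y).
Proof. by rewrite /rdot adjP. Qed.

Lemma rdot_adjC x y : rdot (adj T y) x = rdot y (T x).
Proof. by rewrite rdotC -rdot_adj rdotC. Qed.

Lemma adj_unique y z : (forall x, rdot (T x) y = rdot x z) -> adj T y = z.
Proof.
by move=> h; apply: rdot_ext => x; rewrite !(rdotC _ x) -h rdot_adj.
Qed.

Lemma rnorm_adj_le c : 0 <= c -> (forall x, rnorm (T x) <= c * rnorm x) ->
  forall y, rnorm (adj T y) <= c * rnorm y.
Proof.
move=> c0 hc y; apply: rnorm_le_rdot => [|x]; first by rewrite mulr_ge0 ?rnorm_ge0.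
rewrite rdot_adjC; apply: le_trans (rdot_le _ _) _.
by rewrite mulrC mulrAC ler_wpM2r ?rnorm_ge0.
Qed.

Lemma adj_bounded_linear : bounded_linear (adj T).
Proof.
split=> [a y z|]; last first.
  have [c c0 hc] := bounded_linear_bound; exists c.
  exact: rnorm_adj_le (ltW c0) hc.
apply: rdot_ext => x.
rewrite rdotDl rdotZC !rdot_adjC rdotDl; congr (_ + _).
by rewrite bounded_linearZ rdotZC.
Qed.

Lemma bounded_linear_cvg I (f : set_system I) {Ff : Filter f} (u : I -> E) x :
  u @ f --> x -> (T (u i)) @[i --> f] --> T x.
Proof.
move=> /cvg_rnormP ux; apply/cvg_rnormP => e e0.
have [c c0 hc] := bounded_linear_bound.
apply: filterS (ux (e / c) (divr_gt0 e0 c0)) => i.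
rewrite ltr_pdivlMr// mulrC -bounded_linearB.
by apply: le_lt_trans.
Qed.

End OneOperator.

Lemma bounded_linear_comp E F G (T : E -> F) (S : F -> G) :
  bounded_linear T -> bounded_linear S -> bounded_linear (S \o T).
Proof.
move=> bT bS; split=> [a x y|].
  by rewrite /= (bounded_linearD bT) (bounded_linearD bS) (bounded_linearZ bT)
    (bounded_linearZ bS).
have [c c0 hc] := bounded_linear_bound bT.
have [d d0 hd] := bounded_linear_bound bS.
exists (d * c) => x; apply: le_trans (hd _) _.
by rewrite -mulrA ler_pM2l.
Qed.

Lemma bounded_linear_add E F (T S : E -> F) :
  bounded_linear T -> bounded_linear S -> bounded_linear (fun x => T x + S x).
Proof.
move=> bT bS; split=> [a x y|].
  by rewrite (bounded_linearD bT) (bounded_linearD bS) (bounded_linearZ bT)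
    (bounded_linearZ bS) scalerDr addrACA.
have [c c0 hc] := bounded_linear_bound bT.
have [d d0 hd] := bounded_linear_bound bS.
exists (c + d) => x; apply: le_trans (ler_rnormD _ _) _.
by rewrite mulrDl lerD.
Qed.

Lemma bounded_linear_scale E (c : K) : bounded_linear (fun x : E => c *: x).
Proof.
split=> [a x y|]; first by rewrite scalerDr !scalerA mulrC.
by exists (re_part k `|c|) => x; rewrite rnormZ.
Qed.

Lemma bounded_linear_id E : bounded_linear (@id E).
Proof. by split=> // ; exists 1 => x; rewrite mul1r. Qed.

Lemma adj_comp E F G (T : E -> F) (S : F -> G) y :
  bounded_linear T -> bounded_linear S -> adj (S \o T) y = adj T (adj S y).
Proof.
move=> bT bS; apply: (adj_unique (bounded_linear_comp bT bS)) => x.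
by rewrite /= (rdot_adj bS) (rdot_adj bT).
Qed.

Lemma adj_id E (y : E) : adj id y = y.
Proof. exact: adj_unique (bounded_linear_id E) _ _ _. Qed.

Lemma adj_add E F (T S : E -> F) y : bounded_linear T -> bounded_linear S ->
  adj (fun x => T x + S x) y = adj T y + adj S y.
Proof.
move=> bT bS; apply: (adj_unique (bounded_linear_add bT bS)) => x.
by rewrite rdotDl rdotDr (rdot_adj bS) (rdot_adj bT).
Qed.

End BoundedLinear.

(** * The uniform boundedness principle *)

Section UniformBoundedness.
Variables (R : realType) (k : scalar_kind) (H : hilbert R k).

(** The principle is stated for seminorms because it is applied both to norms of
    operators and to absolute values of functionals. *)
Record bounded_seminorm (f : H -> R) := {
  seminormD : forall x y, f (x + y) <= f x + f y;
  seminormN : forall x, f (- x) = f x;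
  seminormZ : forall (r : R) x, 0 <= r -> f (of_real k r *: x) = r * f x;
  seminorm_bound : exists2 c, 0 < c & forall x, f x <= c * rnorm x }.

(** Gliding hump: if the family were not uniformly bounded, one could move along
    a convergent sequence of points, with steps so small that near the limit
    arbitrarily large values of members of the family persist. *)
Lemma uniform_boundedness (P : set (H -> R)) :
    P `<=` bounded_seminorm -> (forall x, exists M, forall f, P f -> f x <= M) ->
  exists2 M, 0 < M & forall f, P f -> forall x, f x <= M * rnorm x.
Proof.
move=> sP bP; apply: contrapT => nb.
have big (M d : R) : 0 < M -> 0 < d ->
    exists f, P f /\ exists2 x, rnorm x = d & M < f x.
  move=> M0 d0; apply: contrapT => h; apply: nb.
  exists (M / d); first exact: divr_gt0.
  move=> f Pf x; have [fD fN fZ [c c0 fb]] := sP _ Pf.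
  have [x0|x0] := eqVneq (rnorm x) 0.
    by apply: le_trans (fb x) _; rewrite x0 !mulr0.
  have x_gt0 : 0 < rnorm x by rewrite lt_def x0 rnorm_ge0.
  rewrite leNgt; apply/negP => hx; apply: h; exists f; split => //.
  exists (of_real k (d / rnorm x) *: x).
    by rewrite rnormZr ger0_norm ?divfK// ltW// divr_gt0.
  rewrite fZ; last exact/ltW/divr_gt0.
  have -> : M = d / rnorm x * (M / d * rnorm x) by field; rewrite x0 lt0r_neq0.
  by rewrite ltr_pM2l// divr_gt0.
(* The new radius is half the old one, so the later moves add up to at most
   twice the new radius; a seminorm bounded by c changes by at most 1 over that
   distance.  Between x + z and x - z, one has a value of f at least f z. *)
have step (s : (H * {posnum R})%type * nat) : exists s' : (H * {posnum R})%type,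
    [/\ rnorm (s'.1 - s.1.1) <= s.1.2%:num, s'.2%:num <= s.1.2%:num / 2
      & exists2 f, P f & forall y, rnorm (y - s'.1) <= 2 * s'.2%:num ->
          s.2%:R <= f y].
  case: s => -[x d] n /=.
  have d0 : 0 < d%:num by [].
  have [f [Pf [z zd fz]]] := big n.+1%:R _ (ltr0Sn _ _) d0.
  have [fD fN fZ [c c0 fb]] := sP _ Pf.
  have [w wd fw] : exists2 w, rnorm (w - x) <= d%:num & n.+1%:R < f w.
    have : f z + f z <= f (x + z) + f (x - z).
      have -> : f z + f z = f (x + z - (x - z)).
        have -> : x + z - (x - z) = of_real k (1 + 1) *: z.
          by rewrite of_realD of_real1 scalerDl scale1r opprB addrC addrA subrK.
        by rewrite fZ ?addr_ge0// mulrDl mul1r.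
      by apply: le_trans (fD _ _) _; rewrite fN.
    have [h|h] := ltP n.+1%:R (f (x + z)) => hz.
      by exists (x + z) => //; rewrite addrAC subrr add0r zd.
    by exists (x - z); [rewrite addrAC subrr add0r rnormN zd|lra].
  have e0 : 0 < Num.min (d%:num / 2) (2 * c)^-1.
    by rewrite lt_min divr_gt0//= invr_gt0 mulr_gt0.
  exists (w, PosNum e0); split => //=; first by rewrite ge_min lexx.
  exists f => // y yw.
  have : f w <= f y + f (w - y) by rewrite -{1}(subrKC y w).
  have := fb (w - y); rewrite rdistC => h1 h2.
  have : c * rnorm (y - w) <= 1.
    rewrite mulrC -ler_pdivlMr// div1r; apply: le_trans yw _.
    rewrite -ler_pdivlMl// -invfM.
    by rewrite ge_min lexx orbT.
  by move: fw; rewrite -natr1; lra.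
have [g gP] := choice step.
pose s := fix s n := if n is m.+1 then g (s m, m) else (0 : H, PosNum (@ltr01 R)).
pose x n := (s n).1; pose d n := (s n).2%:num.
have d_gt0 n : 0 < d n by rewrite /d.
have xS n : rnorm (x n.+1 - x n) <= d n by have [] := gP (s n, n).
have dS n : d n.+1 <= d n / 2 by have [] := gP (s n, n).
have xD n m : rnorm (x (n + m)%N - x n) <= 2 * d n - 2 * d (n + m)%N.
  elim: m => [|m ih]; first by rewrite addn0 !subrr rnorm0.
  apply: le_trans (ler_rdistD (x (n + m)%N) _ _) _.
  by rewrite addnS; have := xS (n + m)%N; have := dS (n + m)%N; lra.
have xd n m : (n <= m)%N -> rnorm (x m - x n) <= 2 * d n.
  by move=> /subnKC <-; apply: le_trans (xD _ _) _; rewrite gerBl mulr_ge0// ltW.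
have dle n : d n <= n.+1%:R^-1.
  elim: n => [|n ih]; first by rewrite invr1.
  apply: le_trans (dS n) _; apply: le_trans (_ : n.+1%:R^-1 / 2 <= _).
    by rewrite ler_pM2r.
  rewrite -invfM lef_pV2 ?posrE ?mulr_gt0// -natrM ler_nat.
  by rewrite muln2 -addnn addSn addnS !ltnS leq_addr.
have [|l xl] := @rnorm_complete _ _ _ x.
  move=> e e0; have /ltr_add_invr[N] : 0 < e / 4 by rewrite divr_gt0.
  rewrite add0r => Ne; exists N => n m Nn Nm.
  apply: le_lt_trans (ler_rdistD (x N) _ _) _.
  rewrite (rdistC (x N)).
  have := xd _ _ Nn; have := xd _ _ Nm; have := le_lt_trans (dle N) Ne; lra.
have ld n : rnorm (l - x n) <= 2 * d n.
  apply/ler_addgt0Pr => e e0; have [N hN] := cvg_rnorm_lt xl e0.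
  apply: le_trans (ler_rdistD (x (maxn N n)) _ _) _.
  by rewrite addrC lerD ?xd ?leq_maxr// ltW// hN// leq_maxl.
have [M hM] := bP l.
have : exists n, M < n%:R.
  by exists (Num.truncn M).+1; rewrite truncnS_gt.
move=> [n]; apply/negP; rewrite -leNgt.
have [_ _ [f Pf hf]] := gP (s n, n).
by apply: le_trans (hf l _) (hM f Pf); exact: (ld n.+1).
Qed.

End UniformBoundedness.

(** * Resolvents of nonnegative self-adjoint operators *)

Section SelfAdjoint.
Variables (R : realType) (k : scalar_kind) (H : hilbert R k) (T : H -> H).
Hypothesis saT : self_adjoint T.
Implicit Types (x y z : H) (e : R).

Lemma self_adjoint_rdot x y : rdot (T x) y = rdot x (T y).
Proof. by rewrite /rdot saT. Qed.

(** A self-adjoint map defined everywhere is bounded: the functionals <., T z>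
    with |z| <= 1 are pointwise bounded by |T x|, hence uniformly bounded. *)
Lemma hellinger_toeplitz : bounded_linear T.
Proof.
have lT : linear T.
  move=> a x y; apply: rdot_ext => z.
  by rewrite self_adjoint_rdot !rdotDl /rdot !hdotZl !saT.
split => //.
pose P := [set f : H -> R | exists2 z, rnorm z <= 1 & f = fun x => `|rdot x (T z)| ].
have [||M M0 hM] := @uniform_boundedness _ _ H P.
- move=> _ [z z1 ->]; split.
  + by move=> x y; rewrite rdotDl ler_normD.
  + by move=> x; rewrite rdotNl normrN.
  + by move=> r x r0; rewrite rdotZl normrM ger0_norm.
  + exists (rnorm (T z) + 1) => [|x]; first by rewrite ltr_wpDl ?rnorm_ge0.
    apply: le_trans (norm_rdot_le _ _) _.
    by rewrite mulrC ler_wpM2r ?rnorm_ge0// lerDl.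
- move=> x; exists (rnorm (T x)) => _ [z z1 ->].
  rewrite -self_adjoint_rdot; apply: le_trans (norm_rdot_le _ _) _.
  by rewrite ler_piMr ?rnorm_ge0.
exists M => x; have [x0|x0] := eqVneq (rnorm x) 0.
  have T0 : T 0 = 0 by have := lT (-1) 0 0; rewrite scaler0 addr0 scaleN1r addNr.
  by rewrite (rnorm_eq0 x0) T0 rnorm0 mulr0.
have x_gt0 : 0 < rnorm x by rewrite lt_def x0 rnorm_ge0.
apply: rnorm_le_rdot => [|y]; first by rewrite mulr_ge0 ?rnorm_ge0// ltW.
pose u := of_real k (rnorm x)^-1 *: x.
have xu : x = of_real k (rnorm x) *: u.
  by rewrite scalerA -of_realM mulfV// of_real1 scale1r.
rewrite self_adjoint_rdot {1}xu rdotZl mulrAC mulrC ler_pM2r//.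
apply: le_trans (ler_norm _) _; rewrite -self_adjoint_rdot rdotC.
apply: (hM (fun x => `|rdot x (T u)|)); exists u => //.
by rewrite rnormZr gtr0_norm ?invr_gt0// mulVf.
Qed.

Hypothesis T_ge0 : forall x, 0 <= rdot (T x) x.

Let P e y := of_real k e *: y + T y.
Let bT := hellinger_toeplitz.

(** From e |x|^2 <= <(e + T) x, x>. *)
Lemma resolvent_coercive e x : 0 < e -> e * rnorm x <= rnorm (P e x).
Proof.
move=> e0; have [x0|x0] := eqVneq (rnorm x) 0.
  by rewrite x0 mulr0 rnorm_ge0.
have x_gt0 : 0 < rnorm x by rewrite lt_def x0 rnorm_ge0.
rewrite -(ler_pM2r x_gt0); apply: le_trans (rdot_le _ _).
by rewrite rdotDl rdotZl rdotxx -mulrA -expr2 lerDl.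
Qed.

Let bP e : bounded_linear (P e).
Proof. exact: bounded_linear_add (bounded_linear_scale _ _) bT. Qed.

(** Coercivity makes the range of e + T closed; a vector z orthogonal to it
    satisfies e |z|^2 <= <(e + T) z, z> = 0. *)
Lemma resolvent_surj e : 0 < e -> forall y, exists x, P e x = y.
Proof.
move=> e0 y; pose W := range (P e).
have sW : real_subspace W.
  split; first by exists 0 => //; exact: bounded_linear0.
    move=> _ _ [x _ <-] [z _ <-].
    by exists (x + z) => //; rewrite bounded_linearD.
  by move=> r _ [x _ <-]; exists (of_real k r *: x) => //; rewrite bounded_linearZ.
have cW : adherent W `<=` W.
  move=> z hz.
  have /choice[u hu] : forall n : nat, exists x, rnorm (z - P e x) < n.+1%:R^-1.
    move=> n; have [|_ [x _ <-] h] := hz n.+1%:R^-1; first by rewrite invr_gt0.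
    by exists x.
  have small (d : R) : 0 < d -> exists N : nat, forall n, (N <= n)%N ->
      rnorm (z - P e (u n)) < d.
    move=> /ltr_add_invr[N]; rewrite add0r => Nd; exists N => n Nn.
    apply: lt_trans (hu n) (le_lt_trans _ Nd).
    by rewrite lef_pV2 ?posrE// ler_nat.
  have [|x ux] := @rnorm_complete _ _ H u.
    move=> d d0; have [|N hN] := small (e * d / 2).
      by rewrite divr_gt0 ?mulr_gt0.
    exists N => n m Nn Nm; rewrite -(ltr_pM2l e0).
    apply: le_lt_trans (resolvent_coercive _ e0) _.
    rewrite (bounded_linearB (bP e)); apply: le_lt_trans (ler_rdistD z _ _) _.
    by rewrite rdistC [ltRHS]splitr ltrD ?hN.
  exists x => //; apply/esym/subr0_eq/rnorm_eq0/eqP.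
  rewrite eq_le rnorm_ge0 andbT; apply/ler_addgt0Pr => d d0; rewrite add0r.
  have d20 : 0 < d / 2 by rewrite divr_gt0.
  have [N hN] := small _ d20.
  have [M hM] := cvg_rnorm_lt (bounded_linear_cvg (bP e) ux) d20.
  apply: le_trans (ler_rdistD (P e (u (maxn N M))) _ _) _.
  rewrite [leRHS]splitr lerD// ltW ?hN ?leq_maxl//.
  by rewrite rdistC hM// leq_maxr.
have [w [x _ <-] hw] := orthogonal_projection y sW cW.
exists x; apply/esym/subr0_eq; move: (y - P e x) hw => z hw.
have /hw : W (P e z) by exists z.
rewrite rdotC => z0; apply/rnorm_eq0/eqP; rewrite -sqrf_eq0 -rdotxx eq_le.
rewrite [in X in _ && X]rdotxx sqr_ge0 andbT -(ler_pM2l e0) mulr0 -z0.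
by rewrite /P rdotDl rdotZl lerDl.
Qed.

Lemma op_invP e : 0 < e ->
  [/\ bounded_linear (op_inv (P e)), cancel (P e) (op_inv (P e))
    & cancel (op_inv (P e)) (P e)].
Proof.
move=> e0.
suff : exists G : H -> H, [/\ bounded_linear G, cancel (P e) G & cancel G (P e)].
  by move=> /(xgetPex (fun=> 0)).
have [G hG] := choice (resolvent_surj e0).
have PI : injective (P e).
  move=> x y xy; apply/subr0_eq/rnorm_eq0/eqP; rewrite eq_le rnorm_ge0 andbT.
  rewrite -(ler_pM2l e0) mulr0; apply: le_trans (resolvent_coercive _ e0) _.
  by rewrite (bounded_linearB (bP e)) xy subrr rnorm0.
exists G; split => // [|x]; last by apply: PI; rewrite hG.
split=> [a x y|].
  apply: PI; rewrite hG (bounded_linearD (bP e)) (bounded_linearZ (bP e)).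
  by rewrite !hG.
exists e^-1 => x; rewrite mulrC ler_pdivlMr// mulrC.
by apply: le_trans (resolvent_coercive _ e0) _; rewrite hG.
Qed.

Let Q e x := of_real k e *: op_inv (P e) x.

Lemma scaled_resolvent_le e x : 0 < e -> rnorm (Q e x) <= rnorm x.
Proof.
move=> e0; have [_ _ GK] := op_invP e0.
rewrite rnormZr gtr0_norm//; apply: le_trans (resolvent_coercive _ e0) _.
by rewrite GK.
Qed.

Lemma scaled_resolventB e x y : 0 < e -> Q e (x - y) = Q e x - Q e y.
Proof.
move=> e0; have [bG _ _] := op_invP e0.
by rewrite /Q (bounded_linearB bG) scalerBr.
Qed.

Lemma scaled_resolvent_range e y : 0 < e -> rnorm (Q e (T y)) <= e * (2 * rnorm y).
Proof.
move=> e0; have [bG KG _] := op_invP e0.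
have -> : T y = P e y - of_real k e *: y by rewrite /P addrC addKr.
rewrite scaled_resolventB//; apply: le_trans (ler_rnormD _ _) _; rewrite rnormN.
rewrite mulrDl mul1r mulrDr lerD//.
  by rewrite /Q KG rnormZr gtr0_norm.
apply: le_trans (scaled_resolvent_le _ e0) _.
by rewrite rnormZr gtr0_norm.
Qed.

(** A vector z orthogonal to the closure of the range satisfies T z = 0, since
    <T z, T z> = <z, T (T z)>. *)
Lemma range_dense : (forall x, T x = 0 -> x = 0) -> forall x, adherent (range T) x.
Proof.
move=> T0 x; pose W := adherent (range T).
have sW : real_subspace W.
  split.
  - move=> e e0; exists 0; last by rewrite subrr rnorm0.
    by exists 0 => //; exact: bounded_linear0.
  - move=> y z hy hz e e0; have e20 : 0 < e / 2 by rewrite divr_gt0.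
    have [_ [y' _ <-] hy'] := hy _ e20; have [_ [z' _ <-] hz'] := hz _ e20.
    exists (T (y' + z')); first by exists (y' + z').
    rewrite bounded_linearD// opprD addrACA; apply: le_lt_trans (ler_rnormD _ _) _.
    by rewrite [ltRHS]splitr ltrD.
  - move=> r y hy e e0; have r0 : 0 < `|r| + 1 by rewrite ltr_wpDl.
    have [_ [y' _ <-] hy'] := hy _ (divr_gt0 e0 r0).
    exists (T (of_real k r *: y')); first by exists (of_real k r *: y').
    rewrite bounded_linearZ// -scalerBr rnormZr.
    apply: le_lt_trans (_ : (`|r| + 1) * rnorm (y - T y') < _).
      by rewrite ler_wpM2r ?rnorm_ge0// lerDl.
    by rewrite mulrC -ltr_pdivlMr.
have cW : adherent W `<=` W.
  move=> y hy e e0; have e20 : 0 < e / 2 by rewrite divr_gt0.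
  have [z /(_ _ e20)[w Tw hw] hz] := hy _ e20; exists w => //.
  apply: le_lt_trans (ler_rdistD z _ _) _.
  by rewrite [ltRHS]splitr ltrD.
have [w Ww hw] := orthogonal_projection x sW cW.
suff -> : x = w by [].
apply/subr0_eq/T0/rdotxx_eq0; rewrite self_adjoint_rdot hw// => e e0.
by exists (T (T (x - w))); [exists (T (x - w))|rewrite subrr rnorm0].
Qed.

(** Convergence on the dense range of T, extended to the whole space by
    [scaled_resolvent_le]. *)
Lemma scaled_resolvent_strongly_to0 : (forall x, T x = 0 -> x = 0) -> strongly_to0 Q.
Proof.
move=> T0 x; apply/cvg_rnormP => d d0.
have d20 : 0 < d / 2 by rewrite divr_gt0.
have [_ [y _ <-] xy] := range_dense T0 x d20.
have y0 : 0 < 2 * rnorm y + 1 by rewrite ltr_wpDl ?mulr_ge0 ?rnorm_ge0.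
near=> e.
have e0 : 0 < e by near: e; exact: nbhs_right_gt.
have -> : Q e x = Q e (x - T y) + Q e (T y) by rewrite scaled_resolventB// subrK.
rewrite sub0r rnormN; apply: le_lt_trans (ler_rnormD _ _) _.
rewrite [ltRHS]splitr ltrD//.
  exact: le_lt_trans (scaled_resolvent_le _ e0) _.
apply: le_lt_trans (scaled_resolvent_range _ e0) _.
apply: le_lt_trans (_ : e * (2 * rnorm y + 1) < _).
  by rewrite ler_pM2l// lerDl.
rewrite -ltr_pdivlMr//; near: e; apply: nbhs_right_lt.
exact: divr_gt0.
Unshelve. all: by end_near. Qed.

Lemma scaled_resolvent_kernel e x : 0 < e -> T x = 0 -> Q e x = x.
Proof.
move=> e0 Tx; have [bG KG _] := op_invP e0.
by rewrite /Q -(bounded_linearZ bG) -[RHS](KG x) /P Tx addr0.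
Qed.

End SelfAdjoint.

(** * The scalars as a Hilbert space *)

Section ScalarHilbert.
Variables (R : realType) (k : scalar_kind).
Local Notation K := (scalars R k).
Local Notation re := (re_part k).

(** A description of real and imaginary parts that is uniform in k: d is i and c
    is -i for complex scalars, and both are 0 for real ones. *)
Lemma scalar_coordinates : exists c d : K,
  [/\ re `|c| <= 1, re `|d| <= 1
    & forall z, z = of_real k (re z) + d * of_real k (re (c * z))].
Proof.
case: k.
  by exists 0, 0; split => [||z]; rewrite /= ?normr0 ?ler01// mul0r addr0.
exists (Complex 0 (-1) : R[i]), (Complex 0 1 : R[i]); split.
- by rewrite [leLHS](re_part_norm_complex 0 (-1)) expr0n/= add0r sqrrN expr1n sqrtr1.
- by rewrite [leLHS](re_part_norm_complex 0 1) expr0n/= add0r expr1n sqrtr1.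
- move=> [a b]; apply/eqP; rewrite eq_complex /=; apply/andP.
  by split; apply/eqP => /=; ring.
Qed.

Lemma scalars_complete (F : set_system K^o) : ProperFilter F -> cauchy F -> cvg F.
Proof.
move=> FF cF; have [c [d [c1 d1 cd]]] := scalar_coordinates.
have coord (a : K) : re `|a| <= 1 -> cvg ((fun z : K^o => re (a * z)) @ F).
  move=> a1; apply/cauchy_cvgP/cauchy_ballP => e e0.
  have /cauchy_ballP/(_ (of_real k e)) := cF.
  rewrite -[X in X < _](of_real0 R) of_real_lt => /(_ e0).
  case=> -[A B] /= [FA FB] AB.
  exists ((fun z : K^o => re (a * z)) @` A, (fun z : K^o => re (a * z)) @` B) => /=.
    split; [apply: filterS FA|apply: filterS FB] => z ? /=; by exists z.
  move=> [_ _] [/= [z Az <-] [w Bw <-]].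
  have := AB (z, w); rewrite /= -!ball_normE /= => /(_ (conj Az Bw)).
  rewrite (norm_rnorm (_ : K^o)) of_real_lt => zw.
  rewrite -re_partN -re_partD -mulrN -mulrDr.
  apply: le_lt_trans (ler_norm_re_part _) _.
  rewrite -[X in re X]/(`|(a *: (z - w) : K^o)|) -/(rnorm _) rnormZ.
  by apply: le_lt_trans zw; rewrite ler_piMl ?rnorm_ge0.
have one1 : re `|1 : K| <= 1 by rewrite normr1 -(of_real1 R) re_part_of_real.
have /cvg_ex[/= a ha] := coord _ one1; have /cvg_ex[/= b hb] := coord _ c1.
apply/cvg_ex; exists (of_real k a + d * of_real k b : K^o).
apply: (cvg_rnormP (V := K^o) (F := F) id _).2 => e e0.
have e20 : 0 < e / 2 by rewrite divr_gt0.
move/cvgrPdist_lt/(_ _ e20): ha; move/cvgrPdist_lt/(_ _ e20): hb.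
apply: filterS2 => z hb ha; rewrite mul1r in ha.
rewrite [in X in rnorm X](cd z) opprD addrACA -mulrN -mulrDr -!of_realN -!of_realD.
apply: le_lt_trans (ler_rnormD (_ : K^o) _) _.
rewrite [ltRHS]splitr ltrD//.
  by rewrite /rnorm norm_of_real re_part_of_real.
rewrite -[d * _]/(d *: (_ : K^o)) rnormZ.
apply: le_lt_trans hb; rewrite /rnorm norm_of_real re_part_of_real.
by rewrite ler_piMl.
Qed.

Definition scalar_space : completeNormedModType K :=
  HB.pack K^o (Uniform_isComplete.Build K^o scalars_complete).

Definition scalar_form (x y : scalar_space) : K := (x : K) * sconj k (y : K).

Lemma scalar_formC x y :
  scalar_form x y = (-1) ^+ false * sconj k (scalar_form y x).
Proof. by rewrite /scalar_form expr0 mul1r sconjM sconjK mulrC. Qed.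

Lemma scalar_form_norm (x : K) : scalar_form x x = of_real k (rnorm (x : K^o) ^+ 2).
Proof. exact: mul_sconj. Qed.

Lemma scalar_form_gt0 (x : scalar_space) : x != 0 -> 0 < scalar_form x x.
Proof.
move=> x0; rewrite scalar_form_norm -[X in X < _](of_real0 R) of_real_lt.
rewrite exprn_gt0// lt_def rnorm_ge0 andbT; apply: contraNneq x0.
by move=> /rnorm_eq0 ->.
Qed.

Definition scalar_dot : {dot scalar_space for sconj k} :=
  HB.pack scalar_form
   (isBilinear.Build K scalar_space scalar_space K ( *%R ) (sconj k \; *%R) scalar_form
     (fun y x x' => mulrBl (sconj k y) x x')
     (fun x y y' => etrans (congr1 ( *%R x) (sconjB y y')) (mulrBr (x : K) _ _))
     (fun y a x => esym (mulrA a x (sconj k y)))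
     (fun x a y => etrans (congr1 ( *%R x) (sconjM a y)) (mulrCA (x : K) _ _)))
   (isHermitianSesquilinear.Build K scalar_space false (sconj k) scalar_form scalar_formC)
   (isDotProduct.Build K scalar_space scalar_form scalar_form_gt0).

Lemma scalar_dot_norm (x : scalar_space) : `|x| ^+ 2 = scalar_dot x x.
Proof. by rewrite [RHS]scalar_form_norm norm_rnorm !expr2 of_realM. Qed.

(** It makes the integrals of inner products, which are scalar valued, instances
    of Bochner integrals in a Hilbert space. *)
Definition scalar_hilbert : hilbert R k := Hilbert scalar_dot_norm.

End ScalarHilbert.

(** * Step functions and real integrals over segments *)

Section StepFunctions.
Variables (R : realType).
Local Notation mu := (@lebesgue_measure R).

(** Any codomain is allowed, so that pairs of step functions, and pairs of a time
    and a vector, are again step functions. *)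
Definition step (T : Type) (q : R -> T) :=
  finite_set (range q) /\ forall z, measurable (q @^-1` [set z]).

Lemma step_preimage (T : Type) (q : R -> T) (A : set T) : step q ->
  measurable (q @^-1` A).
Proof.
move=> [fq mq]; have -> : q @^-1` A = \bigcup_(z in range q `&` A) q @^-1` [set z].
  apply/seteqP; split => [s As|s [z [_ Az] /= ->]//].
  by exists (q s) => //; split => //; exists s.
by apply: fin_bigcup_measurable => // ; apply: finite_setIl.
Qed.

Lemma step_comp (T T' : Type) (phi : T -> T') (q : R -> T) :
  step q -> step (phi \o q).
Proof.
move=> sq; split; last by move=> z; rewrite comp_preimage; exact: step_preimage.
have [fq _] := sq; apply: sub_finite_set (finite_image phi fq).
by move=> _ [s _ <-]; exists (q s) => //; exists s.
Qed.

Lemma step_pair (T T' : Type) (q : R -> T) (r : R -> T') :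
  step q -> step r -> step (fun s => (q s, r s)).
Proof.
move=> [fq mq] [fr mr]; split => [|[z w]].
  apply: sub_finite_set (finite_setX fq fr) => _ [s _ <-].
  by split; exists s.
rewrite (_ : _ @^-1` _ = q @^-1` [set z] `&` r @^-1` [set w]); first exact: measurableI.
by apply/seteqP; split => s /= [-> ->].
Qed.

Lemma step_cst (T : Type) (z : T) : step (fun=> z : T).
Proof.
split => [|w]; first by apply: sub_finite_set (finite_set1 z) => _ [s _ <-].
by rewrite preimage_cst; case: ifP.
Qed.

Lemma step_if (T : Type) (E : set R) (q r : R -> T) : measurable E ->
  step q -> step r -> step (fun s => if s \in E then q s else r s).
Proof.
move=> mE [fq mq] [fr mr]; split => [|z].
  apply: sub_finite_set (_ : finite_set (range q `|` range r)).
    by move=> _ [s _ <-]; case: ifP => _; [left|right]; exists s.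
  by rewrite finite_setU.
rewrite (_ : _ @^-1` _ = (E `&` q @^-1` [set z]) `|` (~` E `&` r @^-1` [set z])).
  by apply: measurableU; apply: measurableI => //; exact: measurableC.
apply/seteqP; split => s /=.
  by case: ifPn; rewrite ?inE ?notin_setE; [left|right].
move=> [[Es <-]|[Es <-]]; first by rewrite mem_set.
by rewrite memNset.
Qed.

Lemma step_measurable (q : R -> R) (D : set R) : step q -> measurable_fun D q.
Proof. by move=> sq mD Y mY; apply: measurableI => //; exact: step_preimage. Qed.

Lemma segment_finite (a b : R) : (mu `[a, b]%classic < +oo)%E.
Proof. by rewrite lebesgue_measure_itv/=; case: ifP => _; rewrite ltry. Qed.

Lemma bounded_integrable (a b M : R) (f : R -> R) : measurable_fun `[a, b] f ->
  (forall s, s \in `[a, b] -> `|f s| <= M) -> mu.-integrable `[a, b] (EFin \o f).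
Proof.
move=> mf fM; apply: measurable_bounded_integrable => //; first exact: segment_finite.
by exists M; split => [|N MN s /fM /le_trans]; rewrite ?num_real//; apply; exact: ltW.
Qed.

Lemma segment_integrable_le (a b : R) (f g : R -> R) : measurable_fun `[a, b] f ->
    (forall s, s \in `[a, b] -> `|f s| <= g s) ->
  mu.-integrable `[a, b] (EFin \o g) -> mu.-integrable `[a, b] (EFin \o f).
Proof.
move=> mf fg; apply: le_integrable => //; first exact/measurable_EFinP.
by move=> s sab; rewrite lee_fin; apply: le_trans (fg s sab) (ler_norm _).
Qed.

Lemma segment_integrableZ (a b r : R) (f : R -> R) :
    mu.-integrable `[a, b] (EFin \o f) ->
  mu.-integrable `[a, b] (EFin \o (fun s => r * f s)).
Proof.
move=> intf; rewrite (_ : EFin \o _ = (fun s => r%:E * (EFin \o f) s)%E).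
  exact: integrableZl.
by apply/funext => s /=; rewrite EFinM.
Qed.

Lemma segment_integrableD (a b : R) (f g : R -> R) :
    mu.-integrable `[a, b] (EFin \o f) -> mu.-integrable `[a, b] (EFin \o g) ->
  mu.-integrable `[a, b] (EFin \o (fun s => f s + g s)).
Proof.
move=> intf intg.
rewrite (_ : EFin \o _ = (EFin \o f) \+ (EFin \o g))%E; first exact: integrableD.
by apply/funext => s /=; rewrite EFinD.
Qed.

Lemma segment_integrableB (a b : R) (f g : R -> R) :
    mu.-integrable `[a, b] (EFin \o f) -> mu.-integrable `[a, b] (EFin \o g) ->
  mu.-integrable `[a, b] (EFin \o (fun s => f s - g s)).
Proof.
move=> intf intg.
rewrite (_ : EFin \o _ = (EFin \o f) \- (EFin \o g))%E; first exact: integrableB.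
by apply/funext => s /=; rewrite EFinB.
Qed.

Lemma Rintegral_split (a c b : R) (f : R -> R) : a <= c -> c <= b ->
    mu.-integrable `[a, b] (EFin \o f) ->
  \int[mu]_(s in `[a, b]) f s =
    \int[mu]_(s in `[a, c]) f s + \int[mu]_(s in `[c, b]) f s.
Proof.
move=> ac cb intf; apply/eqP; rewrite addrC -subr_eq; apply/eqP.
rewrite Rintegral_itvB ?bnd_simp//; apply: Rintegral_itv_obnd_cbnd.
by apply: integrableS intf => //; apply: subset_itv; rewrite bnd_simp.
Qed.

Lemma segment_length (a b : R) : a <= b -> fine (mu `[a, b]%classic) = b - a.
Proof.
move=> ab; rewrite lebesgue_measure_itv /= lte_fin.
by case: ltP => //= ba; rewrite (le_anti (introT andP (conj ab ba))) subrr.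
Qed.

Lemma norm_Rintegral_le (a b M : R) (f : R -> R) : a <= b ->
    mu.-integrable `[a, b] (EFin \o f) -> (forall s, s \in `[a, b] -> `|f s| <= M) ->
  `|\int[mu]_(s in `[a, b]) f s| <= M * (b - a).
Proof.
move=> ab intf fM; apply: le_trans (le_normr_Rintegral _ intf) _ => //.
have -> : M * (b - a) = \int[mu]_(s in `[a, b]) (cst M s).
  by rewrite Rintegral_cst//; congr (_ * _); rewrite segment_length.
apply: le_Rintegral => //; first exact: integrable_norm.
by apply: (bounded_integrable (M := `|M|)) => //; exact: measurable_cst.
Qed.

Lemma Rintegral_shift (h r : R) (g : R -> R) : 0 <= h -> continuous g ->
  \int[mu]_(s in `[0, h]) g (s + r) = \int[mu]_(s in `[r, h + r]) g s.
Proof.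
move=> h0 cg; rewrite /Rintegral; congr fine; apply/esym.
have shiftE : derive1 (fun s : R => s + r) = cst 1.
  by apply/funext => s; rewrite derive1E deriveD// derive_id derive_cst addr0.
have := @integration_by_substitution_increasing R (fun s => s + r) g 0 h h0.
rewrite shiftE add0r => ->.
- by apply: eq_integral => s _ /=; rewrite mulr1.
- by move=> x y _ _ xy; rewrite ltrD2r.
- by move=> x _; exact: cvg_cst.
- exact: is_cvg_cst.
- exact: is_cvg_cst.
- split => [x _||].
  + exact: derivableD.
  + by apply: cvg_at_right_filter; apply: cvgD; [exact: cvg_id|exact: cvg_cst].
  + by apply: cvg_at_left_filter; apply: cvgD; [exact: cvg_id|exact: cvg_cst].
- exact: continuous_subspaceT.
Qed.

Lemma segment_integrable_cst (a b r : R) :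
  mu.-integrable `[a, b] (EFin \o cst r).
Proof.
apply: (bounded_integrable (M := `|r|)); last by move=> s _ /=.
exact: measurable_cst.
Qed.

Lemma continuous_segment_integrable (a b : R) (g : R -> R) : continuous g ->
  mu.-integrable `[a, b] (EFin \o g).
Proof.
move=> cg; apply: continuous_compact_integrable; first exact: segment_compact.
exact: continuous_subspaceT.
Qed.

(** The functions phi o g are integrated as combinations of the indicators of the
    level sets of g. *)
Lemma step_decomposition (T : choiceType) (g : R -> T) (phi : T -> R) s : step g ->
  (phi (g s))%:E = (\sum_(z <- finmap.enum_fset (fset_set (range g)))
    ((phi z)%:E * (\1_(g @^-1` [set z]) s)%:E))%E.
Proof.
move=> [fg _].
rewrite (bigD1_seq (g s)) ?finmap.fset_uniq//=; last first.
  by rewrite in_fset_set// inE; exists s.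
rewrite big1 => [|z zs].
  by rewrite indicE mem_set// mule1 adde0.
by rewrite indicE memNset ?mule0//= => zE; rewrite zE eqxx in zs.
Qed.

Lemma indic_integrable (a b : R) (A : set R) : measurable A ->
  mu.-integrable `[a, b] (EFin \o \1_A).
Proof.
move=> mA; apply: (bounded_integrable (M := 1)); first exact: measurable_indic.
by move=> s _; rewrite indicE; case: (_ \in _); rewrite ?normr1 ?normr0.
Qed.

Lemma step_integrable (T : choiceType) (a b : R) (g : R -> T) (phi : T -> R) :
  step g -> mu.-integrable `[a, b] (EFin \o (phi \o g)).
Proof.
move=> sg; rewrite [X in _.-integrable _ X](funext (fun s => step_decomposition phi s sg)).
apply: integrable_sum => // z _.
by apply: integrableZl => //; apply: indic_integrable; case: sg.
Qed.

Lemma step_Rintegral (T : choiceType) (a b : R) (g : R -> T) (phi : T -> R) :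
  step g -> \int[mu]_(s in `[a, b]) phi (g s) =
    \sum_(z <- finmap.enum_fset (fset_set (range g)))
      fine (mu (`[a, b]%classic `&` g @^-1` [set z])) * phi z.
Proof.
move=> sg; have mg z : measurable (g @^-1` [set z]) by case: sg.
rewrite /Rintegral.
under eq_integral do rewrite (step_decomposition _ _ sg).
rewrite integral_sum//; last first.
  by move=> z; apply: integrableZl => //; exact: indic_integrable.
have intE z : (\int[mu]_(s in `[a, b]) ((phi z)%:E * (\1_(g @^-1` [set z]) s)%:E) =
    (fine (mu (`[a, b]%classic `&` g @^-1` [set z])) * phi z)%:E)%E.
  rewrite integralZl//; last exact: indic_integrable.
  rewrite integral_indic; [|by []|exact: mg]; rewrite setIC mulrC EFinM fineK// ge0_fin_numE//.
  apply: le_lt_trans (segment_finite a b).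
  by apply: le_measure; rewrite ?inE//; apply: measurableI => //; exact: mg.
under eq_bigr do rewrite intE.
by rewrite sumEFin.
Qed.

End StepFunctions.

(** * Approximation by simple functions *)

Section Bochner.
Variables (R : realType) (k : scalar_kind).
Local Notation mu := (@lebesgue_measure R).

Section Measurability.
Variables (V : normedModType (scalars R k)).
Implicit Types (a b : R) (f : R -> V).

Definition bochner_integrable a b f :=
  strongly_measurable a b f /\ mu.-integrable `[a, b] (EFin \o (@rnorm R k V \o f)).

Lemma strongly_measurable_comp a b f (phi : V -> R) : strongly_measurable a b f ->
    (forall (u : nat -> V) x, u @ \oo --> x -> (phi (u n)) @[n --> \oo] --> phi x) ->
  measurable_fun `[a, b] (phi \o f).
Proof.
move=> [g sg gf] cphi.
apply: (measurable_fun_cvg (h := fun n s => phi (g n s))).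
  by move=> n; apply: step_measurable; apply: (step_comp phi (sg n)).
by move=> s sab; apply: cphi; apply: gf.
Qed.

Lemma cvg_rnorm (u : nat -> V) x : u @ \oo --> x -> rnorm (u n) @[n --> \oo] --> rnorm x.
Proof.
move=> /cvg_rnormP ux; apply/cvgrPdist_lt => e e0; apply: filterS (ux _ e0) => n.
apply: le_lt_trans; rewrite ler_norml.
have := ler_rnormD (x - u n) (u n); rewrite subrK.
have := ler_rnormD (u n - x) x; rewrite subrK (rdistC _ x) => h1 h2.
by apply/andP; split; lra.
Qed.

Lemma strongly_measurable_rnorm a b f : strongly_measurable a b f ->
  measurable_fun `[a, b] (@rnorm R k V \o f).
Proof. by move=> mf; apply: strongly_measurable_comp mf cvg_rnorm. Qed.

Lemma strongly_measurable_dist a b f (g : R -> V) :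
  strongly_measurable a b f -> is_simple g ->
  measurable_fun `[a, b] (fun s => rnorm (f s - g s)).
Proof.
move=> [h sh hf] sg; apply: (@strongly_measurable_rnorm _ _ (fun s => f s - g s)).
exists (fun n s => h n s - g s) => [n|s sab].
  exact: (step_comp (fun z : V * V => z.1 - z.2) (step_pair (sh n) sg)).
by apply: cvgB; [exact: hf|exact: cvg_cst].
Qed.

Lemma dist_integrable a b f (g : R -> V) :
  bochner_integrable a b f -> is_simple g ->
  mu.-integrable `[a, b] (EFin \o (fun s => rnorm (f s - g s))).
Proof.
move=> [mf intf] sg.
apply: le_integrable (_ : mu.-integrable _
  ((EFin \o (@rnorm R k V \o f)) \+ (EFin \o (@rnorm R k V \o g)))%E) => //.
- by apply/measurable_EFinP; exact: strongly_measurable_dist.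
- move=> s _ /=; rewrite lee_fin !ger0_norm ?addr_ge0 ?rnorm_ge0//.
  by apply: le_trans (ler_rnormD _ _) _; rewrite rnormN.
- by apply: integrableD => //; exact: (step_integrable a b (@rnorm R k V) sg).
Qed.

(** Replacing g n by 0 wherever |g n| > 2 |f| keeps it simple and pointwise
    convergent to f, and bounds |f - g n| by 3 |f|; dominated convergence
    applies. *)
Lemma simple_approximation a b f : bochner_integrable a b f ->
  exists g : nat -> R -> V, (forall n, is_simple (g n)) /\
   (\int[mu]_(s in `[a, b]) rnorm (f s - g n s)) @[n --> \oo] --> 0.
Proof.
move=> [mf intf]; have [g sg gf] := mf.
pose E n := `[a, b]%classic `&` [set s | rnorm (g n s) <= 2 * rnorm (f s)].
have mE n : measurable (E n).
  apply: measurable_fun_le => //.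
    by apply: step_measurable; exact: (step_comp (@rnorm R k V) (sg n)).
  by apply: measurable_funM => //; exact: strongly_measurable_rnorm.
pose h n s := if s \in E n then g n s else 0.
have sh n : is_simple (h n) by apply: step_if; [exact: mE|exact: sg|exact: step_cst].
have hle n s : rnorm (f s - h n s) <= 3 * rnorm (f s).
  rewrite /h; case: ifPn => [|_]; last by rewrite subr0 ler_peMl ?rnorm_ge0 ?ler1n.
  rewrite inE => -[_ /= hs]; apply: le_trans (ler_rnormD _ _) _; rewrite rnormN.
  by apply: le_trans (lerD (lexx _) hs) _; lra.
have hf s : s \in `[a, b] -> rnorm (f s - h n s) @[n --> \oo] --> 0.
  move=> sab; have gs := gf s sab.
  have [f0|f0] := eqVneq (rnorm (f s)) 0.
    rewrite [X in X @ _ --> _](_ : _ = fun=> 0); first exact: cvg_cst.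
    apply/funext => n; apply/eqP; rewrite eq_le rnorm_ge0 andbT.
    by apply: le_trans (hle n s) _; rewrite f0 mulr0.
  have f_gt0 : 0 < rnorm (f s) by rewrite lt_def f0 rnorm_ge0.
  have gsP : \forall n \near \oo, rnorm (f s - g n s) < rnorm (f s).
    by move/cvg_rnormP: (gs); apply.
  apply/(cvg_rnorm0 (V := V)); apply: cvg_trans gs; apply: near_eq_cvg.
  apply: filterS gsP => n hn.
  rewrite /h mem_set//; split => //=.
  have := ler_rnormD (g n s - f s) (f s); rewrite subrK rdistC; lra.
exists h; split => //.
have [|||||_ h0 _] := @dominated_convergence _ _ _ mu _ (measurable_itv `[a, b])
   (fun n s => (rnorm (f s - h n s))%:E) (cst 0%E) (fun s => (3 * rnorm (f s))%:E).
- by move=> n; apply/measurable_EFinP; exact: strongly_measurable_dist.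
- exact: measurable_cst.
- by apply: aeW => s sab; apply/fine_cvgP; split; [exact: nearW|exact: hf].
- exact: segment_integrableZ intf.
- apply: aeW => s n _ /=; rewrite lee_fin ger0_norm ?rnorm_ge0//.
move/fine_cvgP: h0 => [_]; apply: cvg_trans; apply: near_eq_cvg; apply: nearW => n /=.
by congr fine; apply: eq_integral => s _; rewrite /= oppr0 addr0 ger0_norm ?rnorm_ge0.
Qed.

End Measurability.
End Bochner.

(** * The Bochner integral in a Hilbert space *)

Section BochnerHilbert.
Variables (R : realType) (k : scalar_kind).
Local Notation mu := (@lebesgue_measure R).

Section OneSpace.
Variable H : hilbert R k.
Implicit Types (a b : R) (f g : R -> H) (y v : H).

Lemma simple_integral_rdot a b g y : is_simple g ->
  rdot (simple_integral a b g) y = \int[mu]_(s in `[a, b]) rdot (g s) y.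
Proof.
move=> sg; rewrite /simple_integral fsbig_finite; last by case: sg.
rewrite (big_morph (fun x => rdot x y) (fun x x' => rdotDl x x' y) (rdot0l y)).
rewrite (step_Rintegral a b (fun z => rdot z y) sg).
by apply: eq_bigr => z _; rewrite rdotZl.
Qed.

Lemma cvg_rdot (u : nat -> H) v y : u @ \oo --> v ->
  rdot (u n) y @[n --> \oo] --> rdot v y.
Proof.
move=> /cvg_rnormP uv; apply/cvgrPdist_lt => e e0.
have y0 : 0 < rnorm y + 1 by rewrite ltr_wpDl ?rnorm_ge0.
apply: filterS (uv _ (divr_gt0 e0 y0)) => n; rewrite ltr_pdivlMr// -rdotBl => h.
apply: le_lt_trans (norm_rdot_le _ _) _; apply: le_lt_trans h.
by rewrite ler_wpM2l ?rnorm_ge0// lerDl.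
Qed.

Lemma rdot_integrable a b f y : bochner_integrable a b f ->
  mu.-integrable `[a, b] (EFin \o (fun s => rdot (f s) y)).
Proof.
move=> [mf intf].
apply: (segment_integrable_le _ _ (segment_integrableZ (rnorm y) intf)).
  apply: (strongly_measurable_comp (phi := fun z => rdot z y) mf) => u x.
  exact: cvg_rdot.
by move=> s _ /=; rewrite mulrC norm_rdot_le.
Qed.

Lemma simple_integral_dist a b f g y : bochner_integrable a b f -> is_simple g ->
  `|rdot (simple_integral a b g) y - \int[mu]_(s in `[a, b]) rdot (f s) y| <=
  rnorm y * \int[mu]_(s in `[a, b]) rnorm (f s - g s).
Proof.
move=> bf sg; rewrite simple_integral_rdot// distrC.
have ig := step_integrable a b (fun z => rdot z y) sg.
have ifg := dist_integrable bf sg.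
rewrite -RintegralB//; last exact: rdot_integrable.
have idiff : mu.-integrable `[a, b] (EFin \o (fun s => rdot (f s) y - rdot (g s) y)).
  exact: segment_integrableB (rdot_integrable y bf) ig.
apply: le_trans (le_normr_Rintegral _ idiff) _ => //.
rewrite -RintegralZl//; apply: le_Rintegral => //.
- exact: integrable_norm.
- exact: segment_integrableZ.
- by move=> s _; rewrite -rdotBl mulrC norm_rdot_le.
Qed.

Lemma dist_integral_cvg a b f (g : nat -> R -> H) :
    bochner_integrable a b f -> (forall n, is_simple (g n)) ->
  (\int[mu]_(s in `[a, b]) (rnorm (f s - g n s))%:E)%E @[n --> \oo] --> 0%E <->
  (\int[mu]_(s in `[a, b]) rnorm (f s - g n s)) @[n --> \oo] --> 0.
Proof.
move=> bf sg; split; first by move=> /fine_cvgP[].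
move=> h; apply/fine_cvgP; split => //; apply: nearW => n.
exact: integrable_fin_num (dist_integrable bf (sg n)).
Qed.

Lemma is_bochner_integral_rdot a b f v y : bochner_integrable a b f ->
  is_bochner_integral a b f v -> rdot v y = \int[mu]_(s in `[a, b]) rdot (f s) y.
Proof.
move=> bf [_ [g [sg /(dist_integral_cvg bf sg) fg gv]]].
have c1 := cvg_rdot (y := y) gv.
suff c2 : rdot (simple_integral a b (g n)) y @[n --> \oo] -->
    \int[mu]_(s in `[a, b]) rdot (f s) y.
  exact: cvg_unique c1 c2.
apply/cvgrPdist_lt => e e0.
have y0 : 0 < rnorm y + 1 by rewrite ltr_wpDl ?rnorm_ge0.
move/cvgrPdist_lt/(_ _ (divr_gt0 e0 y0)): fg; apply: filterS => n.
rewrite sub0r normrN => h; rewrite distrC.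
apply: le_lt_trans (simple_integral_dist _ bf (sg n)) _.
rewrite ltr_pdivlMr// mulrC in h; apply: le_lt_trans h.
apply: le_trans (_ : rnorm y * `|\int[mu]_(s in `[a, b]) rnorm (f s - g n s)| <= _).
  by rewrite ler_wpM2l ?rnorm_ge0// ler_norm.
by rewrite ler_wpM2r// lerDl.
Qed.

(** By [simple_integral_dist] the integrals of two approximations of f differ, in
    every direction y, by at most |y| times the sum of their distances to f; they
    form a Cauchy sequence. *)
Lemma bochner_integral_exists a b f : bochner_integrable a b f ->
  exists v, is_bochner_integral a b f v.
Proof.
move=> bf; have [g [sg fg]] := simple_approximation bf.
pose A n := \int[mu]_(s in `[a, b]) rnorm (f s - g n s).
have A0 n : 0 <= A n by apply: Rintegral_ge0 => s _; exact: rnorm_ge0.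
have [|v gv] := @rnorm_complete _ _ _ (fun n => simple_integral a b (g n)).
  move=> e e0; have e20 : 0 < e / 2 by rewrite divr_gt0.
  move/cvgrPdist_lt/(_ _ e20): fg => [N _ hN]; exists N => n m Nn Nm.
  have := hN n Nn; have := hN m Nm; rewrite /= !sub0r !normrN => hm hn.
  have hm' := le_lt_trans (ler_norm _) hm; have hn' := le_lt_trans (ler_norm _) hn.
  apply: le_lt_trans (_ : A n + A m < e); last by rewrite [ltRHS]splitr ltrD.
  apply: rnorm_le_rdot => [|y]; first by rewrite addr_ge0.
  have := simple_integral_dist y bf (sg n); have := simple_integral_dist y bf (sg m).
  rewrite -/(A n) -/(A m) rdotBl !ler_norml => /andP[h1 h2] /andP[h3 h4].
  by rewrite mulrDl !(mulrC _ (rnorm y)); lra.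
by exists v; split; [case: bf|exists g; split => //; exact/dist_integral_cvg].
Qed.

Lemma bochner_rdot a b f y : bochner_integrable a b f ->
  rdot (bochner a b f) y = \int[mu]_(s in `[a, b]) rdot (f s) y.
Proof.
move=> bf; apply: is_bochner_integral_rdot => //.
exact: (xgetPex 0 (bochner_integral_exists bf)).
Qed.

End OneSpace.

Lemma strongly_measurable_bounded_linear (E F : hilbert R k) (T : E -> F) a b f :
  bounded_linear T -> strongly_measurable a b f -> strongly_measurable a b (T \o f).
Proof.
move=> bT [g sg gf]; exists (fun n => T \o g n) => [n|s sab].
  exact: step_comp (sg n).
exact: bounded_linear_cvg (gf s sab).
Qed.

Lemma bochner_integrable_le (E F : hilbert R k) a b (f : R -> E) (g : R -> F) (c : R) :
    strongly_measurable a b g -> bochner_integrable a b f ->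
    (forall s, s \in `[a, b] -> rnorm (g s) <= c * rnorm (f s)) ->
  bochner_integrable a b g.
Proof.
move=> mg [mf intf] gf; split => //.
apply: (segment_integrable_le _ _ (segment_integrableZ c intf)).
  exact: strongly_measurable_rnorm.
by move=> s sab /=; rewrite ger0_norm ?rnorm_ge0// gf.
Qed.

Lemma bochner_integrable_bounded_linear (E F : hilbert R k) (T : E -> F) a b f :
  bounded_linear T -> bochner_integrable a b f -> bochner_integrable a b (T \o f).
Proof.
move=> bT bf; have [c c0 hc] := bounded_linear_bound bT.
apply: (bochner_integrable_le (c := c) _ bf) => [|s _]; last exact: hc.
by apply: strongly_measurable_bounded_linear => //; case: bf.
Qed.

(** <T (int f), y> = <int f, T^* y> = int <f, T^* y> = int <T f, y>. *)
Lemma bochner_bounded_linear (E F : hilbert R k) (T : E -> F) a b f :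
    bounded_linear T -> bochner_integrable a b f ->
  T (bochner a b f) = bochner a b (fun s => T (f s)).
Proof.
move=> bT bf; apply: rdot_ext => y.
have bTf := bochner_integrable_bounded_linear bT bf.
rewrite (bochner_rdot _ bTf) (rdot_adj bT) bochner_rdot//.
by apply: eq_Rintegral => s _; rewrite /= (rdot_adj bT).
Qed.

End BochnerHilbert.

(** * Changing and splitting the interval *)

Section IntervalSurgery.
Variables (R : realType) (k : scalar_kind) (V : normedModType (scalars R k)).
Local Notation mu := (@lebesgue_measure R).
Implicit Types (a b c : R) (f g : R -> V).

Lemma strongly_measurableS a b a' b' f : a <= a' -> b' <= b ->
  strongly_measurable a b f -> strongly_measurable a' b' f.
Proof.
move=> aa bb [g sg gf]; exists g => // s; rewrite in_itv => /andP[as' sb'].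
by apply: gf; rewrite in_itv /= (le_trans aa as') (le_trans sb' bb).
Qed.

(** Controls are built from different formulas on the successive intervals
    ]t_(i-1), t_i], so functions are compared on half-open intervals. *)
Lemma strongly_measurable_oc a b f g : (forall s, a < s <= b -> f s = g s) ->
  strongly_measurable a b f -> strongly_measurable a b g.
Proof.
move=> fg [h sh hf].
exists (fun n s => if s \in [set a] then g a else h n s) => [n|s sab].
  by apply: step_if; [exact: measurable_set1|exact: step_cst|exact: sh].
have [->|sa] := eqVneq s a.
  by rewrite mem_set//; exact: cvg_cst.
rewrite memNset; last by move/eqP; apply/negP.
rewrite -fg; first exact: hf.
move: (sab); rewrite in_itv /= => /andP[as' ->].
by rewrite lt_neqAle eq_sym sa as'.
Qed.

Lemma strongly_measurable_glue a c b f : a <= c -> c <= b ->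
  strongly_measurable a c f -> strongly_measurable c b f -> strongly_measurable a b f.
Proof.
move=> ac cb [g sg gf] [h sh hf].
exists (fun n s => if s \in `[a, c]%classic then g n s else h n s) => [n|s sab].
  by apply: step_if; [exact: measurable_itv|exact: sg|exact: sh].
have [sac|/negP sac] := boolP (s \in `[a, c]).
  by rewrite mem_set//; exact: gf.
rewrite memNset//; apply: hf; move: sac sab; rewrite !in_itv /= => /negP.
by rewrite negb_and -!ltNge => /orP[sa|cs] /andP[as' ->]; rewrite ?(ltW cs)//;
  move: (lt_le_trans sa as'); rewrite ltxx.
Qed.

Lemma integral_oc a b (f g : R -> R) : (forall s, a < s <= b -> f s = g s) ->
    measurable_fun `[a, b] f -> measurable_fun `[a, b] g ->
  (\int[mu]_(s in `[a, b]) (f s)%:E = \int[mu]_(s in `[a, b]) (g s)%:E)%E.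
Proof.
move=> fg mf mg; rewrite -!integral_itv_obnd_cbnd.
- by apply: eq_integral => s; rewrite inE /= in_itv /= => /fg ->.
- apply/measurable_EFinP; apply: measurable_funS mg => //.
  by apply: subset_itvr; rewrite bnd_simp.
- apply/measurable_EFinP; apply: measurable_funS mf => //.
  by apply: subset_itvr; rewrite bnd_simp.
Qed.

Lemma is_bochner_integral_oc a b f g v : (forall s, a < s <= b -> f s = g s) ->
  is_bochner_integral a b f v -> is_bochner_integral a b g v.
Proof.
move=> fg [mf [h [sh fh hv]]]; have mg := strongly_measurable_oc fg mf.
split => //; exists h; split => //.
rewrite (_ : (fun n => _) = fun n =>
  (\int[mu]_(s in `[a, b]) (rnorm (f s - h n s))%:E)%E)//.
apply/funext => n; apply: integral_oc => [s /fg -> //||];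
  exact: strongly_measurable_dist.
Qed.

Lemma eq_bochner a b f g : (forall s, a < s <= b -> f s = g s) ->
  bochner a b f = bochner a b g.
Proof.
move=> fg; rewrite /bochner; congr (xget 0 _); apply/seteqP; split => v /=;
  by apply: is_bochner_integral_oc => s /fg.
Qed.

Lemma strongly_measurable_sqr a b f : strongly_measurable a b f ->
  measurable_fun `[a, b] (fun s => rnorm (f s) ^+ 2).
Proof.
by move=> mf; apply: measurable_funX; exact: strongly_measurable_rnorm.
Qed.

Lemma L2_integrable a b f : L2 a b f ->
  mu.-integrable `[a, b] (EFin \o (fun s => rnorm (f s) ^+ 2)).
Proof.
move=> [mf intf]; apply/integrableP; split.
  by apply/measurable_EFinP; exact: strongly_measurable_sqr.
by under eq_integral do rewrite /= ger0_norm ?sqr_ge0//.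
Qed.

Lemma L2S a b a' b' f : a <= a' -> b' <= b -> L2 a b f -> L2 a' b' f.
Proof.
move=> aa bb [mf intf]; split; first exact: strongly_measurableS mf.
apply: le_lt_trans intf; apply: ge0_subset_integral => //.
- by apply/measurable_EFinP; exact: strongly_measurable_sqr.
- by move=> s _; rewrite lee_fin sqr_ge0.
- by apply: subset_itv; rewrite bnd_simp.
Qed.

Lemma L2_bounded a b f (M : R) : strongly_measurable a b f ->
  (forall s, s \in `[a, b] -> rnorm (f s) <= M) -> L2 a b f.
Proof.
move=> mf fM; split => //.
have /integrableP[_] : mu.-integrable `[a, b] (EFin \o (fun s => rnorm (f s) ^+ 2)).
  apply: (bounded_integrable (M := M ^+ 2)); first exact: strongly_measurable_sqr.
  move=> s /fM fM'; rewrite ger0_norm ?sqr_ge0// ler_sqr ?nnegrE ?rnorm_ge0//.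
  exact: le_trans (rnorm_ge0 _) fM'.
by under eq_integral do rewrite /= ger0_norm ?sqr_ge0//.
Qed.

Lemma L2_bochner_integrable a b f : L2 a b f -> bochner_integrable a b f.
Proof.
move=> f2; have [mf _] := f2; split => //.
apply: (segment_integrable_le (g := fun s => 1 + rnorm (f s) ^+ 2)).
- exact: strongly_measurable_rnorm.
- move=> s _ /=; rewrite ger0_norm ?rnorm_ge0//.
  by have := sqr_ge0 (rnorm (f s) - 1); rewrite sqrrB mulr1 expr1n; 
    have := rnorm_ge0 (f s); lra.
- apply: segment_integrableD (L2_integrable f2).
  by apply: (bounded_integrable (M := 1)); [exact: measurable_cst|rewrite normr1].
Qed.

Lemma L2_oc a b f g : (forall s, a < s <= b -> f s = g s) -> L2 a b f -> L2 a b g.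
Proof.
move=> fg [mf f2]; have mg := strongly_measurable_oc fg mf; split => //.
apply: le_lt_trans f2; rewrite le_eqVlt; apply/orP; left; apply/eqP/integral_oc.
- by move=> s /fg ->.
- exact: strongly_measurable_sqr.
- exact: strongly_measurable_sqr.
Qed.

Lemma L2_glue a c b f : a <= c -> c <= b -> L2 a c f -> L2 c b f -> L2 a b f.
Proof.
move=> ac cb [mac fac] [mcb fcb].
have mab := strongly_measurable_glue ac cb mac mcb; split => //.
have m2 : measurable_fun `[a, b] (fun s => (rnorm (f s) ^+ 2)%:E).
  by apply/measurable_EFinP; exact: strongly_measurable_sqr.
have abE : `[a, b]%classic = `[a, c]%classic `|` `]c, b]%classic.
  by rewrite -itv_bndbnd_setU ?bnd_simp.
rewrite abE ge0_integral_setU//=.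
- apply: lte_add_pinfty => //; apply: le_lt_trans fcb.
  apply: ge0_subset_integral => //.
  + by apply: measurable_funS m2 => //; apply: subset_itv; rewrite bnd_simp.
  + by move=> s _; rewrite lee_fin sqr_ge0.
  + by apply: subset_itvr; rewrite bnd_simp.
- by rewrite -abE.
- by move=> s _; rewrite lee_fin sqr_ge0.
- apply/disj_setPLR => s /=; rewrite !in_itv/= => /andP[_ sc] /andP[cs _].
  by move: (le_lt_trans sc cs); rewrite ltxx.
Qed.

Lemma L2_norm_eq0 a b f : L2 a b f -> \int[mu]_(s in `[a, b]) rnorm (f s) ^+ 2 = 0 ->
  {ae mu, forall s, s \in `[a, b] -> f s = 0}.
Proof.
move=> f2 f0; have intf := L2_integrable f2; have [mf _] := f2.
have mf2 : measurable_fun `[a, b] (EFin \o (fun s => rnorm (f s) ^+ 2)).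
  by apply/measurable_EFinP; exact: strongly_measurable_sqr.
have /(ae_eq_integral_abs mu (measurable_itv _) mf2) :
    (\int[mu]_(s in `[a, b]) `|(EFin \o (fun s => (rnorm (f s) ^+ 2)%R)) s| = 0)%E.
  under eq_integral do rewrite /= ger0_norm ?sqr_ge0//.
  by rewrite -[LHS]fineK ?[fine _]f0//; exact: integrable_fin_num intf.
apply: filterS => s h sab; have /eqP := h sab.
by rewrite /= eqe sqrf_eq0 => /eqP /rnorm_eq0.
Qed.

End IntervalSurgery.

(** * Integrals of inner products *)

Section InnerProductIntegral.
Variables (R : realType) (k : scalar_kind) (H : hilbert R k).
Local Notation mu := (@lebesgue_measure R).
Local Notation K := (scalars R k).
Implicit Types (a b c : R) (f g : R -> H).

Lemma bochner_split a c b f : a <= c -> c <= b -> bochner_integrable a b f ->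
  bochner a b f = bochner a c f + bochner c b f.
Proof.
move=> ac cb bf; have [mf intf] := bf.
have bac : bochner_integrable a c f.
  split; first exact: strongly_measurableS mf.
  apply: integrableS intf => //; apply: subset_itv; rewrite bnd_simp//.
have bcb : bochner_integrable c b f.
  split; first exact: strongly_measurableS mf.
  apply: integrableS intf => //; apply: subset_itv; rewrite bnd_simp//.
apply: rdot_ext => y; have iy := rdot_integrable y bf.
transitivity (\int[mu]_(s in `[a, b]) rdot (f s) y); first exact: bochner_rdot.
rewrite (Rintegral_split ac cb iy) [RHS]rdotDl.
by congr (_ + _); apply/esym; exact: bochner_rdot.
Qed.

Lemma L2_hdot_integrable a b f g : L2 a b f -> L2 a b g ->
  bochner_integrable a b (fun s => '<f s, g s> : scalar_hilbert R k).
Proof.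
move=> f2 g2; have [[u su uf] _] := f2; have [[v sv vg] _] := g2.
have mfg : strongly_measurable a b (fun s => '<f s, g s> : scalar_hilbert R k).
  exists (fun n s => '<u n s, v n s> : K^o) => [n|s sab].
    exact: (step_comp (fun z : H * H => '<z.1, z.2>) (step_pair (su n) (sv n))).
  have /cvg_rnormP us := uf s sab; have /cvg_rnormP vs := vg s sab.
  apply/(cvg_rnormP (V := K^o)) => e e0.
  have F0 : 0 < rnorm (f s) + 1 by rewrite ltr_wpDl ?rnorm_ge0.
  have G0 : 0 < rnorm (g s) + 1 by rewrite ltr_wpDl ?rnorm_ge0.
  have e20 : 0 < e / 2 by rewrite divr_gt0.
  have := us _ (divr_gt0 e20 G0); have := vs _ (divr_gt0 e20 F0).
  have := vs 1 ltr01; apply: filterS3 => n v1 vn un.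
  have -> : '<f s, g s> - '<u n s, v n s> =
      '<f s - u n s, v n s> + '<f s, g s - v n s>.
    by rewrite hdotBl hdotBr; ring.
  apply: le_lt_trans (ler_rnormD (_ : K^o) _) _; rewrite [ltRHS]splitr ltrD//.
    apply: le_lt_trans (norm_hdot_le _ _) _.
    rewrite ltr_pdivlMr// in un; apply: le_lt_trans un.
    rewrite ler_wpM2l ?rnorm_ge0//.
    have := ler_rnormD (v n s - g s) (g s); rewrite subrK rdistC; lra.
  apply: le_lt_trans (norm_hdot_le _ _) _.
  rewrite ltr_pdivlMr// in vn; apply: le_lt_trans vn.
  by rewrite mulrC ler_wpM2l ?rnorm_ge0// lerDl.
split => //.
apply: (segment_integrable_le (g := fun s => rnorm (f s) ^+ 2 + rnorm (g s) ^+ 2)).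
- exact: strongly_measurable_rnorm mfg.
- move=> s _ /=; rewrite ger0_norm ?rnorm_ge0//; apply: le_trans (norm_hdot_le _ _) _.
  by have := sqr_ge0 (rnorm (f s) - rnorm (g s)); rewrite sqrrB;
    have := mulr_ge0 (rnorm_ge0 (f s)) (rnorm_ge0 (g s)); lra.
- by apply: segment_integrableD; exact: L2_integrable.
Qed.

Lemma re_partM_bochner a b (f : R -> scalar_hilbert R k) (c : K) :
    bochner_integrable a b f ->
  re_part k (c * bochner a b f) = \int[mu]_(s in `[a, b]) re_part k (c * f s).
Proof.
move=> bf; have reE (z : scalar_hilbert R k) : re_part k (c * z) = rdot z (sconj k c).
  by rewrite /rdot /= mulrC -[in LHS](sconjK c).
rewrite reE bochner_rdot//.
by apply: eq_Rintegral => s _; rewrite reE.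
Qed.

Lemma re_part_bochner a b (f : R -> scalar_hilbert R k) : bochner_integrable a b f ->
  re_part k (bochner a b f) = \int[mu]_(s in `[a, b]) re_part k (f s).
Proof.
move=> /(re_partM_bochner 1); rewrite mul1r => ->.
by apply: eq_Rintegral => s _; rewrite mul1r.
Qed.

Lemma bochner_hdotC a b f g : L2 a b f -> L2 a b g ->
  bochner (V := K^o) a b (fun s => '<f s, g s>) =
    sconj k (bochner (V := K^o) a b (fun s => '<g s, f s>)).
Proof.
move=> f2 g2; apply: re_part_ext => c.
rewrite [LHS](re_partM_bochner _ (L2_hdot_integrable f2 g2)).
rewrite -[RHS]re_part_conj sconjM sconjK.
rewrite [RHS](re_partM_bochner _ (L2_hdot_integrable g2 f2)).
by apply: eq_Rintegral => s _; rewrite -[LHS]re_part_conj sconjM -hdotC.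
Qed.

Lemma bochner_hdot_ae0 a b f g : L2 a b f -> L2 a b g ->
    {ae mu, forall s, s \in `[a, b] -> g s = 0} ->
  bochner (V := K^o) a b (fun s => '<f s, g s>) = 0.
Proof.
move=> f2 g2 g0; have bfg := L2_hdot_integrable f2 g2.
apply: re_part_ext => c; rewrite [LHS](re_partM_bochner _ bfg) mulr0.
rewrite re_part0; pose h s := re_part k (c * '<f s, g s>).
have mh : measurable_fun `[a, b] (EFin \o h).
  have ih := rdot_integrable (H := scalar_hilbert R k) (sconj k c) bfg.
  rewrite (_ : EFin \o h = EFin \o (fun s => rdot ('<f s, g s> : scalar_hilbert R k)
      (sconj k c : scalar_hilbert R k))); first by case/integrableP: ih.
  by apply/funext => s; rewrite /rdot /= /scalar_form sconjK mulrC.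
have h0 : ae_eq mu `[a, b]%classic (EFin \o h) (cst 0%E).
  case: g0 => N [mN N0 gN]; exists N; split => // s /= hs; apply: gN => /= g0.
  by apply: hs => sab; rewrite /h g0// hdot0r mulr0 re_part0.
have m0 : measurable_fun `[a, b]%classic (cst 0%E : R -> \bar R) by exact: measurable_cst.
have := @ae_eq_integral _ _ _ mu _ (cst 0%E) (EFin \o h) (measurable_itv _) mh m0 h0.
by rewrite [RHS]integral0 => /(congr1 fine).
Qed.

Lemma hdot_bochner a b f y : bochner_integrable a b f ->
  '<bochner a b f, y> = bochner (V := K^o) a b (fun s => '<f s, y>).
Proof.
move=> bf; pose T x : scalar_hilbert R k := '<x, y>.
have bT : bounded_linear T.
  split=> [c x z|]; first by rewrite /T hdotDl hdotZl.
  by exists (rnorm y) => x; rewrite mulrC; exact: norm_hdot_le.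
exact: (bochner_bounded_linear bT bf).
Qed.

End InnerProductIntegral.

(** * Strongly continuous semigroups *)

Section Semigroup.
Variables (R : realType) (k : scalar_kind) (H : hilbert R k).
Local Notation mu := (@lebesgue_measure R).
Implicit Types (S : R -> H -> H) (x y z : H) (r s t : R).

Lemma cvg_at_right0P (f : R -> H) x :
  f t @[t --> 0^'+] --> x <->
  forall e : R, 0 < e -> exists2 d : R, 0 < d &
    forall t, 0 < t < d -> rnorm (x - f t) < e.
Proof.
split=> [/cvg_rnormP fx e /fx [d /= d0 hd]|fx].
  exists d => // t /andP[t0 td]; apply: hd => //=.
  by rewrite sub0r normrN gtr0_norm.
apply/cvg_rnormP => e /fx [d d0 hd]; near=> t; apply: hd.
apply/andP; split; first by near: t; exact: nbhs_right_gt.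
by near: t; exact: nbhs_right_lt.
Unshelve. all: by end_near. Qed.

Lemma semigroup_near0 S x e : C0_semigroup S -> 0 < e ->
  exists2 d, 0 < d & forall t, 0 <= t < d -> rnorm (S t x - x) < e.
Proof.
move=> [_ S0 _ Sc] e0; have [d d0 hd] := (cvg_at_right0P _ _).1 (Sc x) e e0.
exists d => // t /andP[t0 td]; have [<-|tn0] := eqVneq 0 t.
  by rewrite S0 subrr rnorm0.
by rewrite rdistC hd// td lt_def eq_sym tn0 t0.
Qed.

Lemma rnorm_seminorm (T : H -> H) : bounded_linear T ->
  bounded_seminorm (fun x => rnorm (T x)).
Proof.
move=> bT; split => [x y|x|r x r0|].
- by rewrite bounded_linearD// ler_rnormD.
- by rewrite bounded_linearN// rnormN.
- by rewrite bounded_linearZ// rnormZr ger0_norm.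
- exact: bounded_linear_bound.
Qed.

(** Otherwise there are times t n -> 0 with |S (t n)| > n + 1, which contradicts
    uniform boundedness because S (t n) x -> x for each x. *)
Lemma semigroup_bounded_near0 S : C0_semigroup S ->
  exists d M, [/\ 0 < d, 0 < M &
    forall t, 0 <= t <= d -> forall x, rnorm (S t x) <= M * rnorm x].
Proof.
move=> hS; have [bS _ _ _] := hS; apply: contrapT => nb.
have bad (n : nat) : exists t, 0 <= t < n.+1%:R^-1 /\
    exists x, n.+1%:R * rnorm x < rnorm (S t x).
  apply: contrapT => h; apply: nb.
  exists (n.+1%:R^-1 / 2), n.+1%:R; split => //.
  move=> t /andP[t0 tn] x; rewrite leNgt; apply/negP => hx; apply: h; exists t.
  split; last by exists x.
  by rewrite t0 (le_lt_trans tn)// ltr_pdivrMr// ltr_pMr ?invr_gt0// ltr1n.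
have /choice[t ht] := bad.
have t0 n : 0 <= t n by have [/andP[]] := ht n.
pose P := [set f : H -> R | exists n, f = fun x => rnorm (S (t n) x)].
have [||M M0 hM] := @uniform_boundedness _ _ H P.
- by move=> _ [n ->]; apply/rnorm_seminorm/bS.
- move=> x; have [d d0 hd] := semigroup_near0 x hS ltr01.
  have [N] := ltr_add_invr d0; rewrite add0r => Nd.
  exists (rnorm x + 1 + \sum_(i < N) rnorm (S (t i) x)) => _ [n ->].
  have [nN|Nn] := ltnP n N.
    rewrite (bigD1 (Ordinal nN)) //= ler_wpDl ?addr_ge0 ?rnorm_ge0//.
    by rewrite lerDl sumr_ge0// => i _; exact: rnorm_ge0.
  apply: le_trans (_ : rnorm x + 1 <= _); last first.
    by rewrite lerDl sumr_ge0// => i _; exact: rnorm_ge0.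
  have /hd : 0 <= t n < d.
    rewrite t0; apply: lt_trans Nd; have [/andP[_ tn] _] := ht n.
    by apply: lt_le_trans tn _; rewrite lef_pV2 ?posrE// ler_nat.
  have := ler_rnormD (S (t n) x - x) x; rewrite subrK; lra.
have [n Mn] : exists n, M < n%:R.
  by exists (Num.truncn M).+1; rewrite truncnS_gt.
have [_ [x]] := ht n; apply/negP; rewrite -leNgt.
apply: le_trans (hM (fun x => rnorm (S (t n) x)) _ x) _; first by exists n.
by rewrite ler_wpM2r ?rnorm_ge0// (le_trans (ltW Mn))// ler_nat.
Qed.

Lemma semigroup_bounded S T : C0_semigroup S ->
  exists2 M, 0 < M & forall t, 0 <= t <= T -> forall x, rnorm (S t x) <= M * rnorm x.
Proof.
move=> hS; have [d [M [d0 M0 hM]]] := semigroup_bounded_near0 hS.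
have [_ _ SD _] := hS.
have [n Tn] : exists n : nat, T <= n%:R * d.
  exists (Num.truncn (T / d)).+1; rewrite -ler_pdivrMr//.
  by apply: ltW; rewrite truncnS_gt.
suff [M' M'0 hM'] : exists2 M', 0 < M' &
    forall t, 0 <= t <= n%:R * d -> forall x, rnorm (S t x) <= M' * rnorm x.
  by exists M' => // t /andP[t0 tT]; apply: hM'; rewrite t0 (le_trans tT).
elim: n {Tn} => [|n [M' M'0 hM']].
  exists M => // t /andP[t0]; rewrite mul0r => t0' x.
  by apply: hM; rewrite t0 (le_trans t0')// ltW.
exists (M * M' + M) => [|t /andP[t0 tn] x]; first by rewrite addr_gt0// mulr_gt0.
have [td|dt] := leP t d.
  apply: le_trans (hM t _ x) _; first by rewrite t0.
  by rewrite ler_wpM2r ?rnorm_ge0// lerDr mulr_ge0 ?ltW.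
have td0 : 0 <= t - d by rewrite subr_ge0 ltW.
rewrite -(subrKC d t) SD ?(ltW d0)//; apply: le_trans (hM d _ _) _.
  by rewrite lexx ltW.
apply: le_trans (_ : M * (M' * rnorm x) <= _).
  rewrite ler_pM2l// hM'// td0 lerBlDr.
  by apply: le_trans tn _; rewrite -natr1 mulrDl mul1r.
by rewrite mulrA ler_wpM2r ?rnorm_ge0// lerDl ltW.
Qed.

Lemma semigroup_continuous S x s e : C0_semigroup S -> 0 <= s -> 0 < e ->
  exists2 d, 0 < d &
    forall r, 0 <= r -> `|r - s| < d -> rnorm (S r x - S s x) < e.
Proof.
move=> hS s0 e0; have [bS _ SD _] := hS.
have [M M0 hM] := semigroup_bounded (s + 1) hS.
have [d d0 hd] := semigroup_near0 x hS (divr_gt0 e0 M0).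
exists (Num.min d 1) => [|r r0]; first by rewrite lt_min d0 ltr01.
have key u v : 0 <= u -> u <= v -> u <= s + 1 -> v - u < d ->
    rnorm (S v x - S u x) < e.
  move=> u0 uv us vd; rewrite -(subrKC u v) SD ?subr_ge0//.
  rewrite -(bounded_linearB (bS u u0)); apply: le_lt_trans (hM u _ _) _.
    by rewrite u0.
  by rewrite mulrC -ltr_pdivlMr// hd// subr_ge0 uv.
rewrite lt_min => /andP[rd r1]; have [rs|sr] := leP r s.
  rewrite rdistC; apply: key => //; first by lra.
  by move: rd; rewrite distrC ger0_norm// subr_ge0.
apply: key => //; [exact: ltW|lra|].
by move: rd; rewrite gtr0_norm// subr_gt0.
Qed.

Lemma semigroup_rdot_continuous S x y : C0_semigroup S ->
  continuous (fun s : R => rdot (S `|s| x) y).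
Proof.
move=> hS s; apply/cvgrPdist_lt => e e0.
have y0 : 0 < rnorm y + 1 by rewrite ltr_wpDl ?rnorm_ge0.
have [d d0 hd] := semigroup_continuous x hS (normr_ge0 s) (divr_gt0 e0 y0).
exists d => //= r; rewrite /ball/= => rd.
rewrite -rdotBl; apply: le_lt_trans (norm_rdot_le _ _) _.
have /hd : `| `|r| - `|s| | < d.
  by apply: le_lt_trans (ler_dist_dist _ _) _; rewrite distrC.
rewrite ltr_pdivlMr// rdistC => /(_ (normr_ge0 _)); apply: le_lt_trans.
by rewrite ler_wpM2l ?rnorm_ge0// lerDl.
Qed.

(** The vector y is the weak integral of s |-> S^*(s) z over [0, h].  Shifting
    the variable gives
    <x, S^*(t) y - y> = int_h^(h+t) <S(s) x, z> - int_0^t <S(s) x, z>,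
    so the orbit of y under the adjoint semigroup is continuous even if that of
    z is not known to be.  The absolute value in S `|s| only extends the integrand
    continuously to the whole line. *)
Lemma adj_semigroup_shift S z h : C0_semigroup S -> 0 < h ->
  exists y, (forall x, rdot x y = \int[mu]_(s in `[0, h]) rdot (S `|s| x) z) /\
    forall e, 0 < e -> exists2 d, 0 < d &
      forall t, 0 <= t < d -> rnorm (adj (S t) y - y) < e.
Proof.
move=> hS h0; have [bS _ SD _] := hS.
have [M M0 hM] := semigroup_bounded (h + 1) hS.
pose F x s := rdot (S `|s| x) z.
have cF x : continuous (F x) by exact: semigroup_rdot_continuous.
have iF x a b : mu.-integrable `[a, b] (EFin \o F x).
  exact: continuous_segment_integrable.
have Fle x s : 0 <= s -> s <= h + 1 -> `|F x s| <= M * rnorm x * rnorm z.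
  move=> s0 sh; apply: le_trans (norm_rdot_le _ _) _; rewrite ger0_norm//.
  by rewrite ler_wpM2r ?rnorm_ge0// hM// s0.
have [|||y hy] := @riesz _ _ H (fun x => \int[mu]_(s in `[0, h]) F x s)
    (M * rnorm z * h).
- move=> x1 x2; rewrite -RintegralD//; apply: eq_Rintegral => s _.
  by rewrite /F bounded_linearD ?rdotDl//; exact: bS.
- move=> r x; rewrite -RintegralZl//; apply: eq_Rintegral => s _.
  by rewrite /F bounded_linearZ ?rdotZl//; exact: bS.
- move=> x; have := @norm_Rintegral_le _ 0 h (M * rnorm x * rnorm z) (F x) (ltW h0) (iF _ _ _).
  rewrite subr0 => H1; apply: le_trans (H1 _) _.
    move=> s; rewrite in_itv /= => /andP[s0 sh]; apply: Fle => //.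
    by rewrite (le_trans sh)// lerDl.
  by rewrite le_eqVlt; apply/orP; left; apply/eqP; ring.
exists y; split => [x|e e0]; first exact/esym/hy.
pose C := 2 * (M * rnorm z) + 1.
have C0 : 0 < C by rewrite ltr_wpDl// mulr_ge0// mulr_ge0 ?rnorm_ge0// ltW.
exists (Num.min 1 (e / C)) => [|t /andP[t0]]; first by rewrite lt_min ltr01 divr_gt0.
rewrite lt_min => /andP[t1 te].
apply: le_lt_trans (_ : t * C < e); last by rewrite -ltr_pdivlMr.
apply: rnorm_le_rdot => [|x]; first by rewrite mulr_ge0// ltW.
rewrite rdotBl (rdot_adjC (bS t t0)) !(rdotC y) -!hy.
have -> : \int[mu]_(s in `[0, h]) F (S t x) s = \int[mu]_(s in `[0, h]) F x (s + t).
  apply: eq_Rintegral => s; rewrite inE /= in_itv /= => /andP[s0 _].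
  by rewrite /F -SD// !ger0_norm// addr_ge0.
rewrite Rintegral_shift//; last exact: ltW.
have th : t <= h + t by rewrite lerDr ltW.
have hh : h <= h + t by rewrite lerDl.
have e1 := Rintegral_split t0 th (iF x 0 (h + t)).
have e2 := Rintegral_split (ltW h0) hh (iF x 0 (h + t)).
have b1 := @norm_Rintegral_le _ 0 t (M * rnorm x * rnorm z) (F x) t0 (iF _ _ _).
have b2 := @norm_Rintegral_le _ h (h + t) (M * rnorm x * rnorm z) (F x) hh (iF _ _ _).
have {}b1 : `|\int[mu]_(s in `[0, t]) F x s| <= M * rnorm x * rnorm z * (t - 0).
  by apply: b1 => s; rewrite in_itv /= => /andP[s0 st]; apply: Fle => //; lra.
have {}b2 : `|\int[mu]_(s in `[h, h + t]) F x s| <= M * rnorm x * rnorm z * (h + t - h).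
  by apply: b2 => s; rewrite in_itv /= => /andP[s0 st]; apply: Fle => //; lra.
move: b1 b2; rewrite !ler_norml => /andP[b1 b1'] /andP[b2 b2'].
have tx : 0 <= t * rnorm x by rewrite mulr_ge0 ?rnorm_ge0.
rewrite /C; lra.
Qed.

(** The vectors with a continuous orbit form a closed subspace W.  If z is
    orthogonal to W, it is orthogonal to the vector of [adj_semigroup_shift] for
    every h > 0, so that int_0^h <S(s) z, z> = 0; for small h the integrand is at
    least |z|^2 / 2. *)
Lemma adj_semigroup_C0 S : C0_semigroup S -> C0_semigroup (fun t => adj (S t)).
Proof.
move=> hS; have [bS S0 SD _] := hS.
pose W := [set z : H | forall e, 0 < e -> exists2 d, 0 < d &
      forall t, 0 <= t < d -> rnorm (adj (S t) z - z) < e].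
have [M M0 hM] := semigroup_bounded 1 hS.
have hM' t : 0 <= t <= 1 -> forall x, rnorm (adj (S t) x) <= M * rnorm x.
  move=> t1; apply: rnorm_adj_le (ltW M0) (hM t t1); apply: bS.
  by case/andP: t1.
have bA t : 0 <= t -> bounded_linear (adj (S t)) by move=> /bS; exact: adj_bounded_linear.
have sW : real_subspace W.
  split.
  - move=> e e0; exists 1 => // t /andP[t0 _].
    by rewrite (bounded_linear0 (bA _ t0)) subrr rnorm0.
  - move=> x y hx hy e e0; have e20 : 0 < e / 2 by rewrite divr_gt0.
    have [d1 d10 h1] := hx _ e20; have [d2 d20 h2] := hy _ e20.
    exists (Num.min d1 d2) => [|t /andP[t0]]; first by rewrite lt_min d10.
    rewrite lt_min => /andP[td1 td2].
    rewrite (bounded_linearD (bA _ t0)) opprD addrACA.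
    apply: le_lt_trans (ler_rnormD _ _) _; rewrite [ltRHS]splitr ltrD//.
      by rewrite h1// t0.
    by rewrite h2// t0.
  - move=> r x hx e e0; have r0 : 0 < `|r| + 1 by rewrite ltr_wpDl.
    have [d d0 hd] := hx _ (divr_gt0 e0 r0); exists d => // t t0d.
    have t0 : 0 <= t by case/andP: t0d.
    rewrite (bounded_linearZ (bA _ t0)) -scalerBr rnormZr.
    apply: le_lt_trans (_ : (`|r| + 1) * rnorm (adj (S t) x - x) < _).
      by rewrite ler_wpM2r ?rnorm_ge0// lerDl.
    by rewrite mulrC -ltr_pdivlMr// hd.
have cW : adherent W `<=` W.
  move=> x hx e e0; have M1 : 0 < M + 1 by rewrite addr_gt0.
  have [y Wy xy] := hx _ (divr_gt0 (divr_gt0 e0 (ltr0n _ 2)) M1).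
  have [d d0 hd] := Wy _ (divr_gt0 e0 (ltr0n _ 2)).
  exists (Num.min d 1) => [|t /andP[t0]]; first by rewrite lt_min d0 ltr01.
  rewrite lt_min => /andP[td t1].
  have -> : adj (S t) x - x = adj (S t) (x - y) + (y - x) + (adj (S t) y - y).
    by rewrite (bounded_linearB (bA _ t0)) addrAC !subrKA.
  apply: le_lt_trans (ler_rnormD _ _) _; rewrite [ltRHS]splitr ltrD//; last first.
    by rewrite hd// t0.
  apply: le_lt_trans (ler_rnormD _ _) _; rewrite (rdistC y).
  apply: le_lt_trans (_ : rnorm (x - y) * (M + 1) < _).
    by rewrite mulrDr mulr1 lerD2r mulrC hM'// t0 ltW.
  by rewrite -ltr_pdivlMr.
have WT z : W z.
  have [w Ww hw] := orthogonal_projection z sW cW.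
  suff -> : z = w by [].
  apply/subr0_eq; move: (z - w) hw => {Ww w}z hw.
  have [z0|z0] := eqVneq (rnorm z) 0; first exact: rnorm_eq0.
  have z_gt0 : 0 < rnorm z by rewrite lt_def z0 rnorm_ge0.
  have z20 : 0 < rnorm z / 2 by rewrite divr_gt0.
  have [d d0 hd] := semigroup_near0 z hS z20.
  have d20 : 0 < d / 2 by rewrite divr_gt0.
  have [y [yE /hw]] := adj_semigroup_shift z hS d20.
  rewrite yE => int0.
  have : rnorm z ^+ 2 / 2 * (d / 2) <= 0.
    rewrite -int0.
    have -> : rnorm z ^+ 2 / 2 * (d / 2) =
        \int[mu]_(s in `[0, d / 2]) cst (rnorm z ^+ 2 / 2) s.
      by rewrite Rintegral_cst// segment_length ?subr0// ltW.
    apply: le_Rintegral => //.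
    - exact: segment_integrable_cst.
    - exact: continuous_segment_integrable (semigroup_rdot_continuous hS).
    - move=> s /=; rewrite in_itv /= => /andP[s0 sd]; rewrite ger0_norm//.
      have /hd sz : 0 <= s < d by rewrite s0 (le_lt_trans sd)// ltr_pdivrMr// ltr_pMr// ltr1n.
      have := norm_rdot_le (S s z - z) z; rewrite rdotBl rdotxx ler_norml => /andP[h1 _].
      have : rnorm (S s z - z) * rnorm z <= rnorm z ^+ 2 / 2.
        by rewrite expr2 mulrAC ler_wpM2r ?rnorm_ge0// ltW.
      lra.
  rewrite leNgt => /negP; case; by rewrite mulr_gt0 ?divr_gt0 ?exprn_gt0.
split => //.
- move=> x; rewrite (_ : S 0 = id) ?adj_id//.
  by apply/funext => z; rewrite S0.
- move=> t s x t0 s0; rewrite -(adj_comp x (bS t t0) (bS s s0)).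
  congr (adj _ x); apply/funext => z /=.
  by rewrite addrC SD.
- move=> x; apply/cvg_at_right0P => e e0; have [d d0 hd] := WT x e e0.
  by exists d => // t /andP[t0 td]; rewrite rdistC hd// td ltW.
Qed.

(** With q n s increasing to s - a through step functions and v n simple and
    converging to u, the functions S (b - a - q n s) (v n s) are simple.  As
    q n s <= s - a, the times stay in [0, b - a], where S is bounded. *)
Lemma semigroup_strongly_measurable S a b (u : R -> H) : C0_semigroup S -> a <= b ->
  strongly_measurable a b u -> strongly_measurable a b (fun s => S (b - s) (u s)).
Proof.
move=> hS ab [v sv vu]; have [bS _ _ _] := hS.
have mD : measurable `[a, b]%classic by exact: measurable_itv.
have mf : measurable_fun `[a, b]%classic (fun s : R => (s - a)%:E).
  by apply/measurable_EFinP; apply: measurable_funB => //; exact: measurable_cst.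
pose q n : R -> R := nnsfun_approx mD mf n.
have f0 s : `[a, b]%classic s -> (0%R <= (s - a)%:E)%E.
  by rewrite /= in_itv /= => /andP[as' _]; rewrite lee_fin subr_ge0.
have sq n : step (q n).
  by split => [|z]; [exact: fimfunP|exact: measurable_funPTI].
have qcvg s : `[a, b]%classic s -> q n s @[n --> \oo] --> s - a.
  by move=> sab; have /fine_cvgP[] := cvg_nnsfun_approx mD mf f0 sab.
have qle n s : `[a, b]%classic s -> q n s <= s - a.
  move=> sab; rewrite -(cvg_lim _ (qcvg s sab))//.
  apply: nondecreasing_cvgn_le; last by apply/cvg_ex; exists (s - a); exact: qcvg.
  by move=> i j ij; exact/lefP/nd_nnsfun_approx.
have [M M0 hM] := semigroup_bounded (b - a) hS.
exists (fun n s => S (b - a - q n s) (v n s)) => [n|s sab].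
  exact: (step_comp (fun z : R * H => S (b - a - z.1) z.2) (step_pair (sq n) (sv n))).
have sab' : `[a, b]%classic s by [].
have /andP[as' sb] : a <= s <= b by move: sab; rewrite in_itv.
apply/cvg_rnormP => e e0; have e20 : 0 < e / 2 by rewrite divr_gt0.
have bs0 : 0 <= b - s by rewrite subr_ge0.
have [d d0 hd] := semigroup_continuous (u s) hS bs0 e20.
have /cvg_rnormP/(_ _ (divr_gt0 e20 M0)) := vu s sab.
have /cvgrPdist_lt/(_ _ d0) := qcvg s sab'.
apply: filterS2 => n qn vn.
set r := b - a - q n s.
have r_ge : b - s <= r by have := qle n s sab'; rewrite /r; lra.
have r0 : 0 <= r := le_trans bs0 r_ge.
have q0 : 0 <= q n s by [].
apply: le_lt_trans (ler_rdistD (S r (u s)) _ _) _.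
rewrite [ltRHS]splitr ltrD//.
  rewrite rdistC hd// /r (_ : _ - (b - s) = s - a - q n s)//.
  by ring.
rewrite -(bounded_linearB (bS r r0)); apply: le_lt_trans (hM r _ _) _.
  by rewrite r0 /r gerBl.
by rewrite mulrC -ltr_pdivlMr.
Qed.

Lemma semigroup_bochner_integrable S a b (u : R -> H) : C0_semigroup S -> a <= b ->
  bochner_integrable a b u -> bochner_integrable a b (fun s => S (b - s) (u s)).
Proof.
move=> hS ab bu; have [M M0 hM] := semigroup_bounded (b - a) hS.
apply: (bochner_integrable_le (c := M) _ bu).
  by apply: semigroup_strongly_measurable => //; case: bu.
move=> s; rewrite in_itv /= => /andP[as' sb]; apply: hM.
by rewrite subr_ge0 sb lerD2l lerN2.
Qed.

Lemma adj_semigroup_L2 (U : hilbert R k) (B : U -> H) S a b z :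
    C0_semigroup S -> bounded_linear B -> a <= b ->
  L2 a b (fun s => adj B (adj (S (b - s)) z)).
Proof.
move=> hS bB ab; have hA := adj_semigroup_C0 hS.
have [M M0 hM] := semigroup_bounded (b - a) hA.
have [c c0 hc] := bounded_linear_bound (adj_bounded_linear bB).
apply: (L2_bounded (M := c * (M * rnorm z))) => [|s].
  apply: (strongly_measurable_bounded_linear (adj_bounded_linear bB)).
  apply: (semigroup_strongly_measurable (u := fun=> z) hA ab).
  by exists (fun _ _ => z) => [_|s _]; [exact: step_cst|exact: cvg_cst].
rewrite in_itv /= => /andP[as' sb].
apply: le_trans (hc _) _; rewrite ler_pM2l//; apply: hM.
by rewrite subr_ge0 sb lerD2l lerN2.
Qed.

End Semigroup.

(** * Flows, jumps and their adjoints *)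

Section System.
Variables (R : realType) (k : scalar_kind) (H U : hilbert R k).
Variable sys : impulsive_system H U.
Local Notation K := (scalars R k).
Local Notation mu := (@lebesgue_measure R).
Local Notation p := (sp sys).
Local Notation b := (sb sys).
Local Notation t := (st sys).
Local Notation S := (sS sys).
Local Notation B := (sB sys).
Local Notation C := (sC sys).
Local Notation D := (sD sys).
Local Notation PT := (S (b - t p)).
Implicit Types (w : control U) (x z phi : H) (r s : R) (i j : nat).

Lemma st_mono i j : (i <= j <= p.+1)%N -> t i <= t j.
Proof.
case/andP=> /subnKC <-; elim: (j - i)%N => [|n ih]; first by rewrite addn0.
rewrite addnS => h; apply: le_trans (ih (ltnW h)) _.
by apply/ltW/st_lt; rewrite -ltnS.
Qed.

Lemma st_pred i : (1 <= i <= p.+1)%N -> t i.-1 <= t i.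
Proof. by move=> /andP[i1 ip]; apply: st_mono; rewrite leq_pred. Qed.

Lemma st_ge0 i : (i <= p.+1)%N -> 0 <= t i.
Proof. by move=> ip; rewrite -[X in X <= _](st_first sys); apply: st_mono. Qed.

Lemma st_le i : (i <= p.+1)%N -> t i <= b.
Proof. by move=> ip; rewrite -(st_last sys); apply: st_mono; rewrite ip leqnn. Qed.

Lemma semigroup_op s : 0 <= s -> bounded_linear (S s).
Proof. by case: (sS_C0 sys) => bS _ _ _; apply: bS. Qed.

Lemma PT_op : bounded_linear PT.
Proof. by apply: semigroup_op; rewrite subr_ge0 st_le. Qed.

Lemma jump_op i : (1 <= i <= p)%N -> bounded_linear (fun x => x + C i x).
Proof.
move=> /(sC_bounded (i := i)) bC; apply: bounded_linear_add bC.
exact: bounded_linear_id.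
Qed.

Lemma SC_op i s : (1 <= i <= p)%N -> s <= t i -> bounded_linear (SC sys i s).
Proof.
move=> ip si; apply: bounded_linear_comp (jump_op ip).
by apply: semigroup_op; rewrite subr_ge0.
Qed.

Lemma SC_adj i s z : (1 <= i <= p)%N -> s <= t i ->
  SCadj sys i s z = adj (SC sys i s) z.
Proof.
move=> ip si; have bS : bounded_linear (S (t i - s)).
  by apply: semigroup_op; rewrite subr_ge0.
rewrite /SCadj [RHS](adj_comp z bS (jump_op ip)); congr (adj _ _).
by rewrite adj_add ?adj_id//; [exact: bounded_linear_id|exact: sC_bounded].
Qed.

Lemma SC_pred_op i : (1 <= i <= p)%N -> bounded_linear (SC sys i (t i.-1)).
Proof.
move=> ip; apply: SC_op => //; apply: st_pred.
by case/andP: ip => -> /leqW ->.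
Qed.

Lemma prodSC_last : prodSC sys p.+1 = id.
Proof. by rewrite /prodSC /index_iota subnn big_nil. Qed.

Lemma prodSCadj_last : prodSCadj sys p.+1 = id.
Proof. by rewrite /prodSCadj big_geq. Qed.

Lemma prodSC_rec i : (i <= p)%N ->
  prodSC sys i = prodSC sys i.+1 \o SC sys i (t i.-1).
Proof.
move=> ip; rewrite /prodSC {1}/index_iota subSn//= -/(index_iota _ _) rev_cons.
elim: (rev _) => [|j l ih] /=; first by rewrite big_cons !big_nil.
by rewrite !big_cons ih.
Qed.

Lemma prodSCadj_rec i : (i <= p)%N ->
  prodSCadj sys i = SCadj sys i (t i.-1) \o prodSCadj sys i.+1.
Proof. by move=> ip; rewrite /prodSCadj big_ltn. Qed.

Lemma prodSC_op_adj i : (1 <= i <= p.+1)%N ->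
  bounded_linear (prodSC sys i) /\
  forall z, prodSCadj sys i z = adj (prodSC sys i) z.
Proof.
case/andP=> i1 /subnKC; move: (p.+1 - i)%N => n; elim: n i i1 => [|n ih] i i1.
  rewrite addn0 => ->; rewrite prodSC_last prodSCadj_last.
  by split=> [|z]; [exact: bounded_linear_id|rewrite adj_id].
rewrite addnS -addSn => E.
have ip : (i <= p)%N by rewrite -ltnS -E leq_addr.
have i1p : (1 <= i <= p)%N by rewrite i1.
have [bP aP] := ih i.+1 isT E.
rewrite prodSC_rec// prodSCadj_rec//; split.
  exact: bounded_linear_comp (SC_pred_op i1p) bP.
move=> z; rewrite (adj_comp z (SC_pred_op i1p) bP) /= aP SC_adj//.
by apply: st_pred; rewrite i1 leqW.
Qed.

Lemma prodSC_op i : (1 <= i <= p.+1)%N -> bounded_linear (prodSC sys i).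
Proof. by move=> /prodSC_op_adj[]. Qed.

Lemma prodSC_adj i z : (1 <= i <= p.+1)%N ->
  prodSCadj sys i z = adj (prodSC sys i) z.
Proof. by move=> /prodSC_op_adj[]. Qed.

Lemma control_L2 w i j : is_control sys w -> (i <= j <= p.+1)%N -> L2 (t i) (t j) w.1.
Proof.
move=> cw /andP[ij jp]; apply: L2S cw; first by rewrite st_ge0// (leq_trans ij).
by rewrite st_le.
Qed.

Lemma control_pred w i : is_control sys w -> (1 <= i <= p.+1)%N ->
  L2 (t i.-1) (t i) w.1.
Proof. by move=> cw /andP[i1 ip]; apply: control_L2; rewrite ?leq_pred. Qed.

Lemma control_flow_integrable w i : is_control sys w -> (1 <= i <= p.+1)%N ->
  bochner_integrable (t i.-1) (t i) (fun s => S (t i - s) (B (w.1 s))).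
Proof.
move=> cw ip; apply: semigroup_bochner_integrable (sS_C0 sys) (st_pred ip) _.
apply: bochner_integrable_bounded_linear (sB_bounded sys) _.
exact/L2_bochner_integrable/control_pred.
Qed.

Lemma control_SC_integrable w i : is_control sys w -> (1 <= i <= p)%N ->
  bochner_integrable (t i.-1) (t i) (fun s => SC sys i s (B (w.1 s))).
Proof.
move=> cw ip; apply: bochner_integrable_bounded_linear (jump_op ip) _.
by apply: control_flow_integrable => //; case/andP: ip => -> /leqW.
Qed.

(** * Mild solutions *)

Definition free_endpoint x := PT (prodSC sys 1 x).

Definition control_flow w i :=
  bochner (t i.-1) (t i) (fun s => SC sys i s (B (w.1 s))).

Lemma jump_flow w i z : is_control sys w -> (1 <= i <= p)%N ->
  let x := S (t i - t i.-1) z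
           + bochner (t i.-1) (t i) (fun s => S (t i - s) (B (w.1 s))) in
  x + C i x = SC sys i (t i.-1) z + control_flow w i.
Proof.
move=> cw ip /=; have ip' : (1 <= i <= p.+1)%N by case/andP: ip => -> /leqW.
rewrite [LHS](bounded_linearD (jump_op ip)); congr (_ + _).
exact: (bochner_bounded_linear (jump_op ip) (control_flow_integrable cw ip')).
Qed.

(** The state is taken after the multiplication by I + C_i but before the impulse
    D_i v_i, and transported to the last jump by the remaining propagators.  In
    this form, passing from i to i + 1 only adds the contributions of the impulse
    of index i and of the flow of index i + 1. *)
Lemma mild_solution_unrolled x0 w (x : R -> H) i :
    is_control sys w -> mild_solution sys x0 w x -> (1 <= i <= p)%N ->
  prodSC sys i.+1 (x (t i) + C i (x (t i))) =
    prodSC sys 1 x0 + \sum_(1 <= j < i.+1) prodSC sys j.+1 (control_flow w j)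
    + \sum_(2 <= j < i.+1) prodSC sys j (D j.-1 (w.2 j.-1)).
Proof.
move=> cw [x1 xS]; elim: i => [//|[_ p1|i ih ip]].
  have bP : bounded_linear (prodSC sys 2) by apply: prodSC_op.
  have i1 : (1 <= 1 <= p)%N by rewrite sp_ge1.
  have -> : x (t 1) = S (t 1 - t 0) x0
      + bochner (t 0) (t 1) (fun s => S (t 1 - s) (B (w.1 s))).
    by rewrite (st_first sys) subr0 x1// lexx st_ge0.
  rewrite (jump_flow _ cw i1) (bounded_linearD bP) big_nat1 big_geq// addr0.
  by rewrite (@prodSC_rec 1) ?sp_ge1.
have ip' : (1 <= i.+1 <= p)%N by case/andP: ip => _ /ltnW.
have ti : t i.+1 < t i.+2 <= t i.+2 by rewrite lexx andbT st_lt// ltnW//; case/andP: ip.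
have bP : bounded_linear (prodSC sys i.+3) by apply: prodSC_op; case/andP: ip.
have bP' : bounded_linear (prodSC sys i.+2) by apply: prodSC_op; case/andP: ip => _ /leqW.
rewrite (xS i.+1 ip' _ ti) (jump_flow _ cw ip) (bounded_linearD bP).
have -> : prodSC sys i.+3 (SC sys i.+2 (t i.+2.-1)
      (x (t i.+1) + C i.+1 (x (t i.+1)) + D i.+1 (w.2 i.+1))) =
    prodSC sys i.+2 (x (t i.+1) + C i.+1 (x (t i.+1)) + D i.+1 (w.2 i.+1)).
  by rewrite (@prodSC_rec i.+2)//; case/andP: ip.
rewrite (bounded_linearD bP') ih//.
have recr (F : nat -> H) m : (m <= i.+2)%N ->
    \sum_(m <= j < i.+3) F j = \sum_(m <= j < i.+2) F j + F i.+2.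
  by move=> mi; rewrite big_nat_recr.
rewrite !recr//= -!addrA; congr (_ + (_ + _)).
by rewrite addrA [RHS]addrC.
Qed.

Lemma mild_solution_endpoint x0 w (x : R -> H) :
    is_control sys w -> mild_solution sys x0 w x ->
  x b = free_endpoint x0 + Mop sys w.
Proof.
move=> cw hx; have pp : (1 <= p <= p)%N by rewrite sp_ge1 leqnn.
have := mild_solution_unrolled cw hx pp; rewrite prodSC_last /= => xp.
have bt : t p < b <= t p.+1 by rewrite (st_last sys) lexx -{1}(st_last sys) st_lt.
case: hx => _ /(_ p pp _ bt) ->; rewrite xp /Mop /free_endpoint.
rewrite !(bounded_linearD PT_op) -!addrA; congr (_ + (_ + _)).
by rewrite addrA [RHS]addrC.
Qed.

(** [trajectory x0 w i] is the solution on [0, t_(i+1)]; later times are given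
    the formula of the last interval and are corrected by the next index. *)
Fixpoint trajectory x0 w i : R -> H :=
  if i is j.+1 then
    fun r => if r <= t i then trajectory x0 w j r else
      let x := trajectory x0 w j (t i) in
      S (r - t i) (x + C i x + D i (w.2 i))
      + bochner (t i) r (fun s => S (r - s) (B (w.1 s)))
  else fun r => S r x0 + bochner 0 r (fun s => S (r - s) (B (w.1 s))).

Lemma trajectory_stable x0 w i j r : (i <= j <= p)%N -> r <= t i.+1 ->
  trajectory x0 w j r = trajectory x0 w i r.
Proof.
case/andP=> /subnKC <-; elim: (j - i)%N => [|n ih] np ri; first by rewrite addn0.
rewrite addnS in np *; rewrite /= (le_trans ri) ?ih//; first exact: ltnW.
by apply: st_mono; rewrite ltnS leq_addr /= leqW// ltnW.
Qed.

Lemma mild_solution_exists x0 w : exists x : R -> H, mild_solution sys x0 w x.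
Proof.
exists (trajectory x0 w p); split=> [r /andP[r0 r1]|[//|i] ip r /andP[ir ri]].
  by rewrite (@trajectory_stable _ _ 0) ?leqnn.
have ip' : (i <= p)%N by case/andP: ip => _ /ltnW.
have ipp : (i.+1 <= p <= p)%N by rewrite leqnn andbT; case/andP: ip.
have ipp' : (i <= p <= p)%N by rewrite leqnn andbT.
rewrite (trajectory_stable _ _ ipp ri) (trajectory_stable _ _ ipp' (lexx _)) /=.
by rewrite leNgt ir.
Qed.

(** * The adjoint of the control operator *)

(** The adjoint state: phi transported backwards from b to t_(i-1)^+. *)
Definition costate i phi := prodSCadj sys i (adj PT phi).

Definition optimal_piece phi i s : U :=
  if (i <= p)%N then adj B (SCadj sys i s (costate i.+1 phi))
  else adj B (adj (S (b - s)) phi).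

(** The recursion encodes the choice of the piece i on ]t_(i-1), t_i]. *)
Fixpoint optimal_until phi i : R -> U :=
  if i is j.+1 then
    fun s => if s <= t j then optimal_until phi j s else optimal_piece phi i s
  else fun=> 0.

(** The explicit form of M^* phi; the control that minimises the energy among
    those that reach M M^* phi. *)
Definition optimal_control phi : control U :=
  (optimal_until phi p.+1, fun i => adj (D i) (costate i.+1 phi)).

Lemma optimal_untilE phi i j s : (1 <= j <= i)%N -> (i <= p.+1)%N ->
  t j.-1 < s <= t j -> optimal_until phi i s = optimal_piece phi j s.
Proof.
move=> + + /andP[js sj]; elim: i => [|i ih /andP[j1]].
  by rewrite leqn0 => /andP[/lt0n_neq0 /negP].
rewrite leq_eqVlt => /predU1P[jE ip|ji ip].
  by rewrite jE /= in js *; rewrite leNgt js.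
rewrite /= (le_trans sj) ?ih ?j1 ?(ltnW ip)//.
by apply: st_mono; rewrite -ltnS ji ltnW.
Qed.

Lemma optimal_controlE phi i s : (1 <= i <= p.+1)%N -> t i.-1 < s <= t i ->
  (optimal_control phi).1 s = optimal_piece phi i s.
Proof. by move=> ip si; apply: optimal_untilE. Qed.

Lemma optimal_piece_L2 phi i : (1 <= i <= p.+1)%N ->
  L2 (t i.-1) (t i) (optimal_piece phi i).
Proof.
move=> /andP[i1 ip]; rewrite /optimal_piece.
have tt : t i.-1 <= t i by apply: st_pred; rewrite i1.
have [ilep|pi] := leqP i p.
  exact: adj_semigroup_L2 (sS_C0 sys) (sB_bounded sys) tt.
have iE : i = p.+1 by apply/eqP; rewrite eqn_leq ip.
rewrite iE -(st_last sys) in tt *.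
exact: adj_semigroup_L2 (sS_C0 sys) (sB_bounded sys) tt.
Qed.

Lemma optimal_until_L2 phi i : (i <= p)%N -> L2 0 (t i.+1) (optimal_until phi i.+1).
Proof.
elim: i => [_|i ih ip].
  have := @optimal_piece_L2 phi 1 isT; rewrite /= (st_first sys).
  by apply: L2_oc => s /andP[s0 _]; rewrite leNgt s0.
apply: (@L2_glue _ _ _ 0 (t i.+1)).
- by rewrite st_ge0// ltnS ltnW.
- by rewrite ltW// st_lt.
- apply: L2_oc (ih (ltnW ip)) => s /andP[_ si].
  by rewrite [RHS]/= si.
- have := @optimal_piece_L2 phi i.+2; rewrite /= => /(_ ip).
  by apply: L2_oc => s /andP[s0 _]; rewrite leNgt s0.
Qed.

Lemma optimal_control_is_control phi : is_control sys (optimal_control phi).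
Proof. by rewrite /is_control -(st_last sys); apply: optimal_until_L2. Qed.

(** T = M M^*, term by term. *)
Lemma controllability_op_Mop phi :
  controllability_op sys phi = Mop sys (optimal_control phi).
Proof.
rewrite /controllability_op /Mop.
apply: (f_equal2 +%R); [apply: (f_equal2 +%R); [apply: (f_equal2 +%R)|]|].
- apply: (f_equal PT); apply: eq_big_nat => i /andP[i1 ip].
  apply: (f_equal (prodSC sys i.+1)); apply: eq_bochner => s si.
  by rewrite (@optimal_controlE _ i) ?i1 ?(ltnW ip)// /optimal_piece -ltnS ip.
- rewrite /Gamma; have bp := st_last sys.
  apply: eq_bochner => s; rewrite -{1}bp => si.
  by rewrite (@optimal_controlE _ p.+1) ?leqnn// /optimal_piece ltnn.
- by apply: (f_equal PT); apply: eq_big_nat => -[|[|i]].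
- by rewrite /Gamma_tilde /= /costate prodSCadj_last.
Qed.

End System.

(** * Controllability *)

Section Controllability.
Variables (R : realType) (k : scalar_kind) (H U : hilbert R k).
Variable sys : impulsive_system H U.
Local Notation K := (scalars R k).
Local Notation mu := (@lebesgue_measure R).
Local Notation p := (sp sys).
Local Notation b := (sb sys).
Local Notation t := (st sys).
Local Notation S := (sS sys).
Local Notation B := (sB sys).
Local Notation D := (sD sys).
Local Notation PT := (S (b - t p)).
Local Notation T := (controllability_op sys).
Local Notation opt := (optimal_control sys).
Implicit Types (w : control U) (x phi : H).

Lemma bochner_partition w w' n : is_control sys w -> is_control sys w' -> (n <= p)%N ->
  \sum_(1 <= i < n.+2) bochner (V := K^o) (t i.-1) (t i) (fun s => '<w.1 s, w'.1 s>) =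
  bochner (V := K^o) 0 (t n.+1) (fun s => '<w.1 s, w'.1 s>).
Proof.
move=> cw cw'; elim: n => [_|n ih np]; first by rewrite big_nat1 /= st_first.
have n0 : (0 <= n.+2 <= p.+1)%N by [].
have := L2_hdot_integrable (control_L2 cw n0) (control_L2 cw' n0).
rewrite st_first => bww.
have tn0 : 0 <= t n.+1 by rewrite st_ge0// ltnS ltnW.
have tn : t n.+1 <= t n.+2 by rewrite ltW// st_lt.
by rewrite big_nat_recr//= ih ?(ltnW np)// [RHS](bochner_split tn0 tn bww).
Qed.

Lemma hdot_flow w phi i : is_control sys w -> (1 <= i <= p)%N ->
  '<PT (prodSC sys i.+1 (control_flow sys w i)), phi> =
  bochner (V := K^o) (t i.-1) (t i) (fun s => '<w.1 s, (opt phi).1 s>).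
Proof.
move=> cw ip; have [i1 ilep] := andP ip.
have ip1 : (1 <= i.+1 <= p.+1)%N by [].
rewrite (adjP (PT_op sys)) (adjP (prodSC_op ip1)) -(prodSC_adj _ ip1).
rewrite (hdot_bochner _ (control_SC_integrable cw ip)).
apply: eq_bochner => s si; have /andP[_ sti] := si.
rewrite (@optimal_controlE _ _ _ _ sys _ i) ?i1 ?leqW// /optimal_piece ilep.
rewrite (adjP (SC_op ip sti)) (adjP (sB_bounded sys)).
by rewrite -(SC_adj _ ip sti).
Qed.

Lemma hdot_last_flow w phi : is_control sys w ->
  '<bochner (t p) b (fun s => S (b - s) (B (w.1 s))), phi> =
  bochner (V := K^o) (t p) (t p.+1) (fun s => '<w.1 s, (opt phi).1 s>).
Proof.
move=> cw; have bf := control_flow_integrable cw (_ : 1 <= p.+1 <= p.+1)%N.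
rewrite -(st_last sys) hdot_bochner; last by apply: bf; rewrite leqnn.
apply: eq_bochner => s si; have /andP[_ sti] := si.
rewrite (@optimal_controlE _ _ _ _ sys _ p.+1) ?leqnn// /optimal_piece ltnn.
have bS : bounded_linear (S (t p.+1 - s)) by apply: semigroup_op; rewrite subr_ge0.
rewrite -(st_last sys) (adjP bS).
by rewrite (adjP (sB_bounded sys)).
Qed.

Lemma hdot_jump w phi i : (1 <= i <= p)%N ->
  '<PT (prodSC sys i.+1 (D i (w.2 i))), phi> = '<w.2 i, (opt phi).2 i>.
Proof.
move=> ip; have ip1 : (1 <= i.+1 <= p.+1)%N by case/andP: ip.
rewrite (adjP (PT_op sys)) (adjP (prodSC_op ip1)) -(prodSC_adj _ ip1).
by rewrite (adjP (sD_bounded ip)).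
Qed.

Lemma hdot_suml I (r : seq I) (P : pred I) (F : I -> H) phi :
  '<\sum_(i <- r | P i) F i, phi> = \sum_(i <- r | P i) '<F i, phi>.
Proof.
by apply: (big_morph (fun x => '<x, phi>)) => [x y|]; [exact: hdotDl|exact: hdot0l].
Qed.

(** The optimal control represents phi o M, and is therefore M^* phi. *)
Lemma hdot_Mop w phi : is_control sys w ->
  '<Mop sys w, phi> = control_dot sys w (opt phi).
Proof.
move=> cw; have bPT := bounded_linear_sum (PT_op sys).
rewrite /Mop !bPT !hdotDl !hdot_suml (hdot_last_flow _ cw).
have -> : \sum_(1 <= i < p.+1) '<PT (prodSC sys i.+1
      (bochner (t i.-1) (t i) (fun s => SC sys i s (B (w.1 s))))), phi> =
    \sum_(1 <= i < p.+1)
      bochner (V := K^o) (t i.-1) (t i) (fun s => '<w.1 s, (opt phi).1 s>).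
  by apply: eq_big_nat => i /andP[i1 ip]; rewrite hdot_flow// i1.
rewrite -addrA; congr (_ + _).
  rewrite -(st_last sys) -(bochner_partition cw)// ?leqnn//.
  - by rewrite [RHS]big_nat_recr.
  - exact: optimal_control_is_control.
have pp : (1 <= p <= p)%N by rewrite sp_ge1 leqnn.
have -> : '<PT (D p (w.2 p)), phi> = '<w.2 p, (opt phi).2 p>.
  by rewrite -(hdot_jump w phi pp) prodSC_last.
rewrite [RHS]big_nat_recr ?sp_ge1//=; congr (_ + _).
rewrite big_add1 /=; apply: eq_big_nat => i /andP[i1 ip].
by apply: hdot_jump; rewrite i1 ltnW.
Qed.

Lemma control_dotC w w' : is_control sys w -> is_control sys w' ->
  control_dot sys w w' = sconj k (control_dot sys w' w).
Proof.
move=> cw cw'; rewrite /control_dot sconjD (bochner_hdotC cw cw'); congr (_ + _).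
rewrite (big_morph (sconj k : K -> K) (@sconjD R k) (sconj0 R k)).
by apply: eq_bigr => i _; rewrite hdotC.
Qed.

Lemma re_control_dot w : is_control sys w ->
  re_part k (control_dot sys w w) = \int[mu]_(s in `[0, b]) rnorm (w.1 s) ^+ 2
    + \sum_(1 <= i < p.+1) rnorm (w.2 i) ^+ 2.
Proof.
move=> cw; rewrite /control_dot re_partD.
rewrite [X in X + _](re_part_bochner (L2_hdot_integrable cw cw)).
rewrite (big_morph (re_part k) (@re_partD R k) (re_part0 R k)).
by congr (_ + _); [apply: eq_Rintegral => s _|apply: eq_bigr => i _];
  rewrite -rdotxx.
Qed.

Lemma re_control_dot_ge0 w : is_control sys w -> 0 <= re_part k (control_dot sys w w).
Proof.
move=> cw; rewrite re_control_dot// addr_ge0//.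
  by apply: Rintegral_ge0 => s _; exact: sqr_ge0.
by apply: sumr_ge0 => i _; exact: sqr_ge0.
Qed.

Lemma re_control_dot_eq0 w : is_control sys w ->
  re_part k (control_dot sys w w) = 0 -> control_eq0 sys w.
Proof.
move=> cw; rewrite re_control_dot// => /eqP.
rewrite paddr_eq0; last 2 first.
- by apply: Rintegral_ge0 => s _; exact: sqr_ge0.
- by apply: sumr_ge0 => i _; exact: sqr_ge0.
case/andP => /eqP int0 /eqP sum0; split; first exact: L2_norm_eq0 cw int0.
move=> i ip; apply/rnorm_eq0/eqP; rewrite -sqrf_eq0; apply/eqP/le_anti.
rewrite sqr_ge0 andbT -sum0 (big_rem i) ?mem_index_iota//=.
by rewrite lerDl sumr_ge0// => j _; exact: sqr_ge0.
Qed.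

Lemma control_dot_eq0 w w' : is_control sys w -> is_control sys w' ->
  control_eq0 sys w' -> control_dot sys w w' = 0.
Proof.
move=> cw cw' [w10 w20]; rewrite /control_dot (bochner_hdot_ae0 cw cw' w10) add0r.
by rewrite big_nat big1// => i ip; rewrite w20// hdot0r.
Qed.

(** The two descriptions of M^* phi may differ on a null set of times and at
    impulses of index outside 1, ..., p, so they are compared only through their
    inner products with controls. *)
Lemma Mop_adjP phi : is_control sys (Mop_adj sys phi) /\
  forall w, is_control sys w -> '<Mop sys w, phi> = control_dot sys w (Mop_adj sys phi).
Proof.
apply: (@xgetPex _ (fun=> 0, fun=> 0) [set w | is_control sys w /\
  forall w', is_control sys w' -> '<Mop sys w', phi> = control_dot sys w' w]).
exists (opt phi); split; first exact: optimal_control_is_control.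
by move=> w cw; exact: hdot_Mop.
Qed.

Lemma hdot_controllability_op phi phi' :
  '<T phi, phi'> = control_dot sys (opt phi) (opt phi').
Proof.
rewrite controllability_op_Mop hdot_Mop//; exact: optimal_control_is_control.
Qed.

Lemma controllability_op_self_adjoint : self_adjoint T.
Proof.
move=> x y; rewrite [RHS]hdotC !hdot_controllability_op.
by apply: control_dotC; exact: optimal_control_is_control.
Qed.

Lemma controllability_op_ge0 x : 0 <= rdot (T x) x.
Proof.
rewrite /rdot hdot_controllability_op.
exact/re_control_dot_ge0/optimal_control_is_control.
Qed.

Lemma free_endpoint0 : free_endpoint sys 0 = 0.
Proof.
have p1 : (1 <= 1 <= p.+1)%N by [].
by rewrite /free_endpoint (bounded_linear0 (prodSC_op p1)) (bounded_linear0 (PT_op sys)).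
Qed.

(** With x_0 = 0, a control that steers to within |phi| of phi would give
    |phi|^2 = <phi - M w, phi> < |phi|^2. *)
Lemma approximately_controllable_Mop_adj : approximately_controllable sys ->
  forall phi, control_eq0 sys (Mop_adj sys phi) -> phi = 0.
Proof.
move=> ac phi adj0; have [cadj adjE] := Mop_adjP phi.
apply: contrapT => phi0.
have phi_gt0 : 0 < rnorm phi.
  by rewrite lt_def rnorm_ge0 andbT; apply/eqP => /rnorm_eq0.
have [w [x [cw xw]]] := ac 0 phi _ phi_gt0.
rewrite (mild_solution_endpoint cw xw) free_endpoint0 add0r rdistC => near.
have := rdot_le (phi - Mop sys w) phi.
rewrite rdotBl {2}/rdot adjE// control_dot_eq0// re_part0 subr0 rdotxx expr2.
by rewrite ler_pM2r// leNgt near.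
Qed.

(** If <T phi, phi> = 0 then the optimal control is null, hence <M w, phi> = 0 for
    every w; taking w = M^* phi shows that M^* phi is null. *)
Lemma Mop_adj_positive :
    (forall phi, control_eq0 sys (Mop_adj sys phi) -> phi = 0) -> positive_op T.
Proof.
move=> adj0; split; first exact: hellinger_toeplitz controllability_op_self_adjoint.
  exact: controllability_op_self_adjoint.
move=> phi phi0; have [cadj adjE] := Mop_adjP phi.
have copt := optimal_control_is_control sys phi.
have real : '<T phi, phi> = of_real k (rdot (T phi) phi).
  apply: sconj_fixed; rewrite -hdotC.
  by rewrite controllability_op_self_adjoint.
rewrite real -[X in X < _](of_real0 R) of_real_lt lt_def controllability_op_ge0 andbT.
apply: contraNneq phi0 => T0; apply/eqP/adj0.
apply: re_control_dot_eq0 => //; rewrite -adjE// hdot_Mop//.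
rewrite control_dot_eq0// ?re_part0//; apply: re_control_dot_eq0 => //.
by rewrite -hdot_controllability_op.
Qed.

(** T y = M (M^* y) can be made close to the target minus the free motion. *)
Lemma range_dense_approximately_controllable :
  (forall x, T x = 0 -> x = 0) -> approximately_controllable sys.
Proof.
move=> T0 x0 h d d0.
have [_ [y _ <-] hy] :=
  range_dense controllability_op_self_adjoint T0 (h - free_endpoint sys x0) d0.
have [x hx] := mild_solution_exists sys x0 (opt y).
have copt := optimal_control_is_control sys y.
exists (opt y), x; split => //.
rewrite (mild_solution_endpoint copt hx) -controllability_op_Mop rdistC.
by rewrite opprD addrA.
Qed.

Lemma strongly_to0_weakly_to0 (F : R -> H -> H) : strongly_to0 F -> weakly_to0 F.
Proof.
move=> sF x y; have /cvg_rnormP Fx := sF x.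
apply/(cvg_rnormP (V := K^o)) => e e0.
have y0 : 0 < rnorm y + 1 by rewrite ltr_wpDl ?rnorm_ge0.
apply: filterS (Fx _ (divr_gt0 e0 y0)) => r.
rewrite !sub0r !rnormN ltr_pdivlMr//; apply: le_lt_trans.
apply: le_trans (norm_hdot_le _ _) _.
by rewrite ler_wpM2l ?rnorm_ge0// lerDl.
Qed.

(** The scaled resolvents fix the null space of T. *)
Lemma weakly_to0_kernel : weakly_to0 (scaled_resolvent sys) ->
  forall x, T x = 0 -> x = 0.
Proof.
move=> wQ x Tx0; apply/rnorm_eq0/eqP; rewrite -sqrf_eq0 -rdotxx; apply/eqP.
suff : rnorm ('<x, x> : scalar_hilbert R k) = 0.
  by move=> /rnorm_eq0 xx0; rewrite /rdot [X in re_part k X]xx0 re_part0.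
apply/le_anti; rewrite rnorm_ge0 andbT; apply/ler_addgt0Pr => e e0; rewrite add0r.
have [d d0 hd] := (cvg_at_right0P (H := scalar_hilbert R k) _ _).1 (wQ x x) e e0.
have d2 : 0 < d / 2 < d by rewrite divr_gt0//= ltr_pdivrMr// ltr_pMr// ltr1n.
have := hd _ d2; rewrite /scaled_resolvent.
have /andP[d20 _] := d2.
have -> := scaled_resolvent_kernel controllability_op_self_adjoint
  controllability_op_ge0 d20 Tx0.
by rewrite sub0r rnormN => /ltW.
Qed.

Lemma positive_kernel : positive_op T -> forall x, T x = 0 -> x = 0.
Proof.
move=> [_ _ T0] x Tx; apply/eqP; apply: contraT => /T0.
by rewrite Tx hdot0l ltxx.
Qed.

End Controllability.

Theorem theorem5 (R : realType) (k : scalar_kind) (H U : hilbert R k)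
    (sys : impulsive_system H U) :
  [<-> approximately_controllable sys;
       forall phi : H, control_eq0 sys (Mop_adj sys phi) -> phi = 0;
       positive_op (controllability_op sys);
       strongly_to0 (scaled_resolvent sys);
       weakly_to0 (scaled_resolvent sys)].
Proof.
tfae.
- exact: approximately_controllable_Mop_adj.
- exact: Mop_adj_positive.
- move=> /positive_kernel; apply: scaled_resolvent_strongly_to0.
    exact: controllability_op_self_adjoint.
  exact: controllability_op_ge0.
- exact: strongly_to0_weakly_to0.
- by move=> /weakly_to0_kernel; exact: range_dense_approximately_controllable.
Qed.
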